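(* Let $(X,\mathsf d,\mathfrak m)$ be a metric measure space with gauge function $\mathsf G$ satisfying the non-triviality condition $$\mathfrak m(\{z\in X: z\ne x,\ \mathsf G(x,z)<+\infty\})>0,\qquad\forall\,x\in\mathrm{supp}\,\mathfrak m.$$ Assume that $(X,\mathsf d,\mathfrak m,\mathsf G)$ satisfies $\mathsf{MCP}(\beta)$, where $\beta$ is a distortion coefficient with parameter $N\in[1,+\infty)$. Then the geodesic dimension of $(X,\mathsf d,\mathfrak m)$ satisfies $$\dim_{\mathrm{geo}}(x)\le N,\qquad\forall\,x\in\mathrm{supp}\,\mathfrak m.$$ In particular, for the Hausdorff dimension it holds $$\dim_{\mathrm{Haus}}(\mathrm{supp}\,\mathfrak m)\le\dim_{\mathrm{geo}}(\mathrm{supp}\,\mathfrak m)\le N.$$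
   Context: A metric measure space is a complete separable metric space $(X,\mathsf d)$ with a non-negative Borel measure $\mathfrak m$ finite on bounded sets; a gauge function is a Borel map $\mathsf G:X\times X\to[0,+\infty]$. **Distortion coefficient with parameter $N$.** Given $\mathsf s:[0,\infty)\to\mathbb R$ continuous with $\mathsf s(\theta)=c\theta^N+o(\theta^N)$ as $\theta\to0$ for some $c>0$, $N\in[1,\infty)$, let $\mathcal D=\inf\{\theta>0:\mathsf s(\theta)=0\}$. For $t\in[0,1]$, $\theta\in[0,+\infty]$: $\beta_t(0)=t^N$; $\beta_t(\theta)=\mathsf s(t\theta)/\mathsf s(\theta)$ if $0<\theta<\mathcal D$; $\beta_t(\theta)=\liminf_{\phi\to\mathcal D^-}\mathsf s(t\phi)/\mathsf s(\phi)$ if $\theta\ge\mathcal D$. **$\mathsf{MCP}(\beta)$.** $W_2$ is the quadratic Wasserstein distance. $\mathrm{Ent}(\mu|\mathfrak m)=\int\rho\log\rho\,d\mathfrak m$ if $\mu=\rho\mathfrak m$ has finite second moment and $\rho\log\rho\in L^1$, $+\infty$ otherwise; $\mathrm U_n(\mu|\mathfrak m)=\exp(-\mathrm{Ent}(\mu|\mathfrak m)/n)$ (equal to $0$ if $\mathrm{Ent}=+\infty$). $\mathcal P_{bs}^*$: probability measures with bounded support in $\mathrm{supp}\,\mathfrak m$ and finite entropy. The condition: for every $\bar x\in\mathrm{supp}\,\mathfrak m$ and $\mu_1\in\mathcal P_{bs}^*$ with $\bar x\notin\mathrm{supp}\,\mu_1$ there is a $W_2$-geodesic $(\mu_t)_{t\in[0,1]}$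 from $\delta_{\bar x}$ to $\mu_1$ with $\mathrm U_n(\mu_t|\mathfrak m)\ge\exp\big(\frac1n\int\log\beta_t(\mathsf G(\bar x,x))\,\mu_1(dx)\big)\mathrm U_n(\mu_1|\mathfrak m)$ for all $t\in(0,1)$, for some (equivalently every) $n\ge1$. **Geodesic dimension.** A geodesic is a curve $\gamma:[0,1]\to X$ with $\mathsf d(\gamma_s,\gamma_t)=|s-t|\mathsf d(\gamma_0,\gamma_1)$. For $x\in X$ and a Borel set $A_1$, $A_t$ is the set of points $\gamma_t$ with $\gamma$ a geodesic, $\gamma_0=x$, $\gamma_1\in A_1$; $\bar{\mathfrak m}$ is the completion of $\mathfrak m$. For $s>0$, $$C_s(x)=\sup\Big\{\limsup_{t\to0^+}\frac1{t^s}\frac{\bar{\mathfrak m}(A_t)}{\mathfrak m(A_1)}: A_1\text{ Borel, bounded, }x\notin A_1,\ \mathfrak m(A_1)\in(0,+\infty)\Big\},$$ $\dim_{\mathrm{geo}}(x)=\inf\{s>0:C_s(x)=+\infty\}=\sup\{s>0:C_s(x)=0\}$, with $\inf\emptyset=+\infty$, $\sup\emptyset=0$. For $S\subset X$, $\dim_{\mathrm{geo}}(S)=\sup_{x\in S}\dim_{\mathrm{geo}}(x)$. $\dim_{\mathrm{Haus}}$ is the Hausdorff dimension with respect to $\mathsf d$. *)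

(* Defs.v *)
From HB Require Import structures.
From mathcomp Require Import all_boot all_order all_algebra.
From mathcomp Require Import all_classical all_reals all_analysis.
From mathcomp Require Import measurable_realfun.

Set Implicit Arguments.
Unset Strict Implicit.
Unset Printing Implicit Defensive.

Import Order.TTheory GRing.Theory Num.Theory.
Import numFieldNormedType.Exports.

Local Open Scope classical_set_scope.
Local Open Scope ring_scope.

#[short(type="completeMetricType")]
HB.structure Definition CompleteMetric (R : numDomainType) :=
  {M of CompletePseudoMetric R M & PseudoMetric_isMetric R M}.

Definition separable (T : topologicalType) : Prop :=
  exists D : set T, countable D /\ dense D.

Notation borel T := (g_sigma_algebraType (@open T)).

(* Supremum in [0, +oo], so that the supremum of the empty set is 0. *)
Definition nnsup {R : realType} (A : set (\bar R)) : \bar R :=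
  ereal_sup (0%E |` A).

Section metric_notions.
Context {R : realType} {X : completeMetricType R}.

Definition diam (A : set X) : \bar R :=
  nnsup [set (mdist xy.1 xy.2)%:E | xy in A `*` A].

Definition mbounded (A : set X) : Prop := (diam A < +oo)%E.

(* A geodesic is a curve on [0, 1]: values of g outside [0, 1] are ignored. *)
Definition geodesic (g : R -> X) : Prop :=
  forall s t, s \in `[0, 1] -> t \in `[0, 1] ->
    mdist (g s) (g t) = `|s - t| * mdist (g 0) (g 1).

Definition intermediate (x : X) (A1 : set X) (t : R) : set X :=
  [set g t | g in [set g | [/\ geodesic g, g 0 = x & A1 (g 1)]]].

Definition hausdorff_pre (s delta : R) (S : set X) : \bar R :=
  ereal_inf [set (\sum_(i <oo) poweR (diam (E i)) s)%E | E in
    [set E : nat -> set X | S `<=` \bigcup_i E i /\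
                            forall i, (diam (E i) <= delta%:E)%E]].

Definition hausdorff_meas (s : R) (S : set X) : \bar R :=
  ereal_sup [set hausdorff_pre s delta S | delta in [set delta | 0 < delta]].

(* Only exponents s > 0 are used: this avoids the convention for diam^0 and
   gives the same infimum. *)
Definition dim_haus (S : set X) : \bar R :=
  ereal_inf [set s%:E | s in [set s : R | 0 < s /\ hausdorff_meas s S = 0%E]].

End metric_notions.

Section measure_notions.
Context {R : realType} {X : completeMetricType R}.
Implicit Types (m : {measure set (borel X) -> \bar R})
  (mu nu : probability (borel X) R).

Definition finite_on_bounded m : Prop :=
  forall A : set X, measurable (A : set (borel X)) -> mbounded A ->
    (m A < +oo)%E.

Definition supp m : set X :=
  [set x | forall U : set X, open U -> U x -> (0 < m U)%E].

Definition gauge (G : X * X -> \bar R) : Prop :=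
  measurable_fun setT (G : borel (X * X)%type -> \bar R) /\
  forall p, (0 <= G p)%E.

(* X is separable in all uses, so the product of the Borel sigma-algebras, over
   which couplings are measures, is the Borel sigma-algebra of X * X. *)
Definition coupling mu nu
    (p : probability (borel X * borel X)%type R) : Prop :=
  forall A : set X, measurable (A : set (borel X)) ->
    p (A `*` setT) = mu A /\ p (setT `*` A) = nu A.

Definition W2 mu nu : \bar R :=
  poweR (ereal_inf [set (\int[p]_xy ((mdist xy.1 xy.2) ^+ 2)%:E)%E |
                     p in coupling mu nu])
    2^-1.

Definition W2_geodesic (mu : R -> probability (borel X) R) : Prop :=
  forall s t, s \in `[0, 1] -> t \in `[0, 1] ->
    W2 (mu s) (mu t) = (`|s - t|%:E * W2 (mu 0%R) (mu 1%R))%E.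

(* Measures are compared on Borel sets only. *)
Definition eq_meas m m' : Prop :=
  forall A : set X, measurable (A : set (borel X)) -> m A = m' A.

Definition finite_second_moment mu : Prop :=
  exists x0 : X, (\int[mu]_x ((mdist x0 x) ^+ 2)%:E < +oo)%E.

Definition is_density mu m (rho : X -> R) : Prop :=
  [/\ measurable_fun setT (rho : borel X -> R), forall x, 0 <= rho x &
      forall A : set X, measurable (A : set (borel X)) ->
        mu A = (\int[m]_(x in A) (rho x)%:E)%E].

Definition density mu m : X -> R := xget (fun=> 0) (is_density mu m).

(* Here ln 0 = 0, hence rho * ln rho = 0 where rho = 0. *)
Definition Ent mu m : \bar R :=
  let rho := density mu m in
  if `[< [/\ is_density mu m rho, finite_second_moment mu &
             m.-integrable setT (fun x => (rho x * ln (rho x))%:E)] >]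
  then (\int[m]_x (rho x * ln (rho x))%:E)%E
  else +oo%E.

Definition Un (n : R) mu m : \bar R := expeR (- (Ent mu m * n^-1%:E)).

Definition Pbs m mu : Prop :=
  [/\ mbounded (supp mu), supp mu `<=` supp m & (Ent mu m < +oo)%E].

Definition MCP m (G : X * X -> \bar R) (beta : R -> \bar R -> \bar R) : Prop :=
  exists2 n : R, 1 <= n &
    forall (xbar : X) mu1, supp m xbar -> Pbs m mu1 -> ~ supp mu1 xbar ->
      exists mu : R -> probability (borel X) R,
        [/\ W2_geodesic mu, eq_meas (mu 0) (\d_(xbar : borel X)),
            eq_meas (mu 1) mu1 &
            forall t, 0 < t < 1 ->
              (expeR (n^-1%:E * \int[mu1]_x lne (beta t (G (xbar, x)))) *
                 Un n mu1 m <= Un n (mu t) m)%E].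

(* The completion of m is the restriction of completed_measure_extension m to
   the completed sigma-algebra, to which intermediate x A1 t belongs when A1 is
   Borel, being a Suslin set. *)
Definition Cgeo m (s : R) (x : X) : \bar R :=
  nnsup [set limf_esup (fun t : R => (((t `^ s)^-1)%:E *
           (@completed_measure_extension _ _ _ m (intermediate x A1 t) / m A1))%E) 0^'+
        | A1 in [set A1 : set X |
            [/\ measurable (A1 : set (borel X)), mbounded A1, ~ A1 x &
                (0 < m A1 < +oo)%E]]].

Definition dim_geo m (x : X) : \bar R :=
  ereal_inf [set s%:E | s in [set s : R | 0 < s /\ Cgeo m s x = +oo%E]].

Definition dim_geo_set m (S : set X) : \bar R := nnsup (dim_geo m @` S).

End measure_notions.

Section distortion.
Context {R : realType}.

Definition first_zero (s : R -> R) : \bar R :=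
  ereal_inf [set theta%:E | theta in [set theta : R | 0 < theta /\ s theta = 0]].

Definition distortion (s : R -> R) (N t : R) (theta : \bar R) : \bar R :=
  let D := first_zero s in
  let ratio (phi : \bar R) := (s (t * fine phi) / s (fine phi))%:E in
  if theta == 0%E then (t `^ N)%:E
  else if (theta < D)%E then ratio theta
  else limf_einf ratio (within [set phi | (phi < D)%E] (nbhs D)).

Definition distortion_coefficient (N : R) (beta : R -> \bar R -> \bar R)
    : Prop :=
  exists (s : R -> R) (c : R),
    [/\ 0 < c, {within `[0, +oo[, continuous s},
        forall x, s x = c * x `^ N +o_(x \near 0^'+) (x `^ N) &
        forall t theta, t \in `[0, 1] -> (0 <= theta)%E ->
          beta t theta = distortion s N t theta].

End distortion.

(* Main.v *)
(* Fix x in supp m and a bounded Borel set A of positive finite mass, at positive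
   distance from x, on which G(x, .) is bounded; there beta_t(G(x, .)) >= k t^N for
   small t. Apply MCP to the normalized restriction mu_1 of m to A: it gives a
   W_2-geodesic (mu_t) from delta_x whose entropy is bounded in terms of k t^N m(A),
   so by Jensen every Borel set of full mu_t-measure has m-mass at least
   k t^N m(A). It remains to find such a set inside the set A_t of intermediate
   points. Nearly optimal couplings of (mu_s, mu_t) nearly saturate the triangle
   inequality d(x, z) <= d(x, y) + d(y, z); by tightness and compactness, up to a
   small mu_t-measure, every point lies on exact geodesic chains over finer and
   finer sets of rational times, ending in A, and these converge to geodesics.
   Hence C_s(x) = +oo for all s > N.

   For the Hausdorff dimension, if s' > dim_geo(x) then A_t is contained in a ball of
   radius O(t), so m(B(x, 2^-n)) >= 2^(-n s') for infinitely many n. For each n a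
   maximal 2^(1-n)-separated set of such points is small because the balls B(x, 2^-n)
   are disjoint, and these covers have arbitrarily small s-dimensional sums when
   s > s'. *)

Require Import Defs.
From HB Require Import structures.
From mathcomp Require Import all_boot all_order all_algebra.
From mathcomp Require Import all_classical all_reals all_analysis.
From mathcomp Require Import measurable_realfun lra ring.

Set Implicit Arguments.
Unset Strict Implicit.
Unset Printing Implicit Defensive.

Import Order.TTheory GRing.Theory Num.Theory.
Import numFieldNormedType.Exports.

Local Open Scope classical_set_scope.
Local Open Scope ring_scope.

(** * Borel sets, tightness and regularity in Polish metric spaces *)

(** The natural tools (optimal couplings, their gluing over many times, measurable selection of
    geodesics) are all avoided, and [A_t] itself is merely a Suslin set. Infima in W_2 are only
    approached, and what travels from one time to the next is a compact set of good points instead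
    of a coupling. Compactness turns approximate relations into exact ones, and compact sets are
    Borel, so countable combinations of them give a Borel subset of [A_t]. Starting at a Dirac mass
    makes this possible: all couplings with it have the same cost, so the second moments of the mu_t
    are known exactly and the total defect of a coupling of (mu_s, mu_t) is determined by its cost.
    Rational times suffice: a limsup at 0 is bounded below along any sequence of times, and a
    geodesic is recovered from a dense set of times by completeness. In the Hausdorff part neither
    doubling nor finite total mass is at hand; the growth of m on large balls is paid for by an
    arbitrarily small part of the exponent. *)

Section metric_topology.
Context {R : realType} {X : completeMetricType R}.
Implicit Types (x y z : X) (A : set X).

Lemma mdist_continuous : continuous (fun p : X * X => mdist p.1 p.2 : R).
Proof.
move=> [x y]; apply/cvgrPdist_lt => e e0 /=.
near=> p; have xp : mdist x p.1 < e / 2 /\ mdist y p.2 < e / 2.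
  near: p; exists (ball x (e / 2), ball y (e / 2)).
    by split; apply: nbhsx_ballx; rewrite divr_gt0.
  by move=> [a b] /= [+ +]; rewrite !ballEmdist/=.
have {xp}[x1 y2] := xp.
have h1 := metric_triangle x p.1 y; have h2 := metric_triangle p.1 p.2 y.
have h3 := metric_triangle p.1 x p.2; have h4 := metric_triangle x y p.2.
rewrite (metric_sym p.1 x) in h3; rewrite (metric_sym p.2 y) in h2.
by rewrite ltr_norml; apply/andP; split; lra.
Unshelve. all: by end_near. Qed.

Lemma mdistl_continuous x : continuous (fun y => mdist x y : R).
Proof.
move=> y; apply: (@continuous_comp _ _ _ (fun y => (x, y))
  (fun p : X * X => mdist p.1 p.2)); last exact: mdist_continuous.
by apply: cvg_pair; [exact: cvg_cst | exact: cvg_id].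
Qed.

Lemma open_mball x (r : R) : open [set y | mdist x y < r].
Proof. by move: (@mdistl_continuous x) => /continuousP/(_ _ (@open_lt _ r)).
  Qed.

Lemma closed_mball x (r : R) : closed [set y | mdist x y <= r].
Proof. by move: (@mdistl_continuous x) => /continuous_closedP/(_ _ (@closed_le
  _ r)). Qed.

Lemma open_mball_subset A x : open A -> A x ->
  exists2 d : R, 0 < d & forall y, mdist x y < d -> A y.
Proof.
move=> oA Ax; have /nbhs_ballP[d /= d0 dA] : nbhs x A.
  by apply: open_nbhs_nbhs.
by exists d => // y xy; apply: dA; rewrite ballEmdist.
Qed.

Lemma open_borel A : open A -> measurable (A : set (borel X)).
Proof. exact: sub_sigma_algebra. Qed.

Lemma closed_borel A : closed A -> measurable (A : set (borel X)).
Proof.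
move=> cA; rewrite -[A]setCK; apply: measurableC; apply: open_borel.
exact: closed_openC.
Qed.

Lemma compact_closed_metric A : compact A -> closed A.
Proof. by apply: compact_closed; exact: metric_hausdorff. Qed.

Lemma compact_borel A : compact A -> measurable (A : set (borel X)).
Proof. by move=> /compact_closed_metric /closed_borel. Qed.

Lemma continuous_borel_measurable (f : X -> R) : continuous f ->
  measurable_fun setT (f : borel X -> R).
Proof.
move=> /continuousP cf; apply: (measurability _ (RGenOpens.measurableE R)).
move=> _ [_ [a [b ->]] <-].
have -> : [set: borel X] `&` f @^-1` `]a, b[%classic = f @^-1` `]a, b[%classic.
  exact: (@setTI X).
by apply: open_borel; apply: cf; apply: interval_open.
Qed.

Lemma mdistl_measurable x : measurable_fun setT (fun y : borel X => mdist x y :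
    R).
Proof.
by apply: (@continuous_borel_measurable (mdist x));
  exact: (@mdistl_continuous x).
Qed.

Lemma separable_seq : separable X -> X -> exists e : nat -> X,
  forall x (r : R), 0 < r -> exists n, mdist x (e n) < r.
Proof.
move=> [D [cD dD]] x0.
move/countable_injP : cD => [i iD].
(* [x0] is the value at integers that code no point of [D]. *)
pose e n := xget x0 [set y | D y /\ i y = n].
exists e => x r r0.
have ne : [set y | mdist x y < r] !=set0 by exists x; rewrite /= mdistxx.
have [y [/= xy Dy]] := dD _ ne (@open_mball x r).
exists (i y); suff -> : e (i y) = y by [].
have [De ie] : [set z | D z /\ i z = i y] (e (i y)).
  by rewrite /e; apply: xgetPex; exists y.
by apply: iD => //; rewrite inE.
Qed.

(** Couplings live on the product sigma-algebra, for which continuity of the distance is not enough: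
    [mdist < r] has to be a countable union of rectangles, here products of balls with a common
    centre [e n] and radii [q] and [r - q], [q] rational. *)
Lemma mdist_measurable : separable X ->
  measurable_fun setT (fun p : borel X * borel X => mdist p.1 p.2 : R).
Proof.
move=> sX; apply: (measurability _ (RGenInftyO.measurableE R)).
move=> _ [_ [r ->] <-].
have [XE|/existsNP[x0 _]] := pselect (X -> False).
  rewrite [Y in measurable Y](_ : _ = set0)//; apply/seteqP;
    split => // -[x y] _.
  exact: (XE x).
have [e eP] := separable_seq sX x0.
pose F n q : set (borel X * borel X) :=
  [set y : X | mdist (e n) y < ratr q] `*` [set z : X | mdist (e n) z < r -
    ratr q].
have mb n s : measurable ([set y : X | mdist (e n) y < s] : set (borel X)).
  by apply: open_borel; exact: open_mball.
rewrite [Y in measurable Y](_ : _ = \bigcup_n \bigcup_q F n q).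
  apply: bigcupT_measurable => n; apply: bigcupT_measurable_rat => q.
  exact: measurableX.
apply/seteqP; split => [[y z]/= [_]|[y z] [n _ [q _ [/= h1 h2]]]].
  rewrite in_itv/= => yzr.
  have [n yn] := eP y ((r - mdist y z) / 2) ltac:(lra).
  have /rat_in_itvoo[q] : mdist y (e n) < r - mdist y z - mdist y (e n) by lra.
  rewrite in_itv/= => /andP[q1 q2].
  exists n => //; exists q => //; split => /=; first by rewrite metric_sym.
  have := metric_triangle (e n) y z; rewrite (metric_sym (e n) y); lra.
split => //=; rewrite in_itv/=.
have := metric_triangle y (e n) z; rewrite (metric_sym y (e n)); lra.
Qed.

(** An ultrafilter containing a finite union of balls contains one of them, so an ultrafilter on [A]
    is Cauchy and completeness gives its limit. *)
Lemma totally_bounded_compact A : closed A ->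
  (forall r : R, 0 < r -> exists s : seq X,
     A `<=` [set y | exists2 x, x \in s & mdist x y < r]) ->
  compact A.
Proof.
move=> cA tbA; rewrite compact_ultra => F FU FA.
have cF : cauchy_ex F.
  move=> r r0; have [s As] := tbA r r0.
  have {As} : F [set y | exists2 x, x \in s & mdist x y < r] by apply: filterS
    FA.
  elim: s => [F0|x s IH Fxs].
    by exfalso; apply: (@filter_not_empty _ F); apply: filterS F0 => y [].
  have [Fx|Fx] := @in_ultra_setVsetC _ F (ball x r) FU; first by exists x.
  apply: IH; apply: filterS2 Fxs Fx => y [z];
    rewrite in_cons => /orP[/eqP->|zs zr].
    by move=> xy; rewrite /setC/= ballEmdist.
  by exists z.
have [p Fp] : exists p : X, F --> p.
  by apply/cvg_ex; exact: (@cauchy_cvg X F _ (cauchy_exP F cF)).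
exists p; split => //; apply: cA => B Bp.
by have [y ABy] := filter_ex (filterI FA (Fp _ Bp)); exists y.
Qed.

End metric_topology.

Lemma measure_exhaust d (T : measurableType d) (R : realType)
    (P : {finite_measure set T -> \bar R}) (A : nat -> set T) (B : set T) :
  (forall n, measurable (A n)) -> measurable B ->
  (forall n m, (n <= m)%N -> A n `<=` A m) -> B `<=` \bigcup_n A n ->
  forall e : R, 0 < e -> exists n, (P (B `\` A n) <= e%:E)%E.
Proof.
move=> mA mB ndA BA e e0.
have mBA n : measurable (B `\` A n) by exact: measurableD.
have I0 : \bigcap_n (B `\` A n) = set0.
  apply/seteqP; split => // x BAx; have [Bx _] := BAx 0%N I.
  by have [n _ Ax] := BA _ Bx; have [] := BAx n I.
have : (P \o (fun n => B `\` A n)) x @[x --> \oo] --> (0 : \bar R)%E.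
  rewrite -(measure0 P) -I0; apply: nonincreasing_cvg_mu => //.
  - by rewrite ltey_eq fin_num_measure.
  - by rewrite I0.
  - by move=> n m nm; apply/subsetPset => x [Bx Ax]; split => // /(ndA _ _ nm).
move=> /fine_cvgP [_] /cvgrPdist_le /(_ _ e0) [n _ /(_ n (leqnn n))] /=.
rewrite sub0r normrN => h; exists n.
rewrite -[leLHS]fineK ?fin_num_measure// lee_fin.
exact: le_trans (ler_norm _) h.
Qed.

Lemma measure_bigcup_le d (T : measurableType d) (R : realType)
    (P : {measure set T -> \bar R}) (A : nat -> set T) (e : R) :
  (forall n, measurable (A n)) -> 0 <= e ->
  (forall n, (P (A n) <= (e / (2 ^ n.+1)%:R)%:E)%E) ->
  (P (\bigcup_n A n) <= e%:E)%E.
Proof.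
move=> mA e0 Ae; apply: (@le_trans _ _ (\sum_(0 <= i <oo) P (A i))%E).
  by apply: measure_sigma_subadditive => //; exact: bigcup_measurable.
apply: le_trans (epsilon_trick0 xpredT e0).
by apply: lee_nneseries => // n _ _; exact: Ae.
Qed.

Section tightness.
Context {R : realType} {X : completeMetricType R}.
Variable P : {finite_measure set (borel X) -> \bar R}.

(** The compact set is an intersection over [n] of finite unions of closed balls of radius
    [1/(n+1)], hence totally bounded; the [n]-th union leaves out mass at most [e / 2^(n+1)]. *)
Lemma ulam_tight : separable X -> forall e : R, 0 < e ->
  exists K : set X, compact K /\ (P (~` K) <= e%:E)%E.
Proof.
move=> sX e e0.
have [XE|/existsNP[x0 _]] := pselect (X -> False).
  exists set0; split; first exact: compact0.
  rewrite (_ : ~` set0 = set0) ?measure0 ?lee_fin ?ltW//.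
  by apply/seteqP; split => // x _; exact: (XE x).
have [u uP] := separable_seq sX x0.
pose r n : R := n.+1%:R^-1.
have r0 n : 0 < r n by rewrite invr_gt0.
pose U n k : set X := \bigcup_(i in `I_k) [set y | mdist (u i) y <= r n].
have cU n k : closed (U n k).
  by apply: closed_bigcup => // i _; exact: closed_mball.
have kP n : exists k, (P (~` (U n k)) <= (e / (2 ^ n.+1)%:R)%:E)%E.
  have [|||||k kP] := @measure_exhaust _ (borel X) R P (U n) setT _ _ _ _ (e /
    (2 ^ n.+1)%:R).
  - by move=> k; exact: closed_borel.
  - exact: measurableT.
  - by move=> i j ij x [l /= li xl]; exists l => //=; exact: leq_trans li ij.
  - move=> x _; have [i xi] := uP x _ (r0 n).
    by exists i.+1 => //; exists i => //=; rewrite metric_sym ltW.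
  - by rewrite divr_gt0.
  by exists k; rewrite -setTD.
have [k {}kP] := choice kP.
exists (\bigcap_n U n (k n)); split.
  apply: totally_bounded_compact; first by apply: closed_bigI.
  move=> d d0; have [n rn] : exists n, r n < d.
    have [n] := ltr_add_invr d0; rewrite add0r => h; by exists n.
  exists [seq u i | i <- iota 0 (k n)] => x /(_ n I) [i /= ik xi].
  exists (u i); last exact: le_lt_trans xi rn.
  by apply: map_f; rewrite mem_iota.
rewrite setC_bigcap; apply: measure_bigcup_le => //; last exact: ltW.
by move=> n; apply: measurableC; exact: closed_borel.
Qed.

(** Two-sided approximation is symmetric under complements, which approximation from inside alone is
    not; this makes the regular sets a sigma-algebra. *)
Let regular (A : set X) := forall e : R, 0 < e -> exists F U : set X,
  [/\ closed F, open U, F `<=` A, A `<=` U & (P (U `\` F) <= e%:E)%E].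

Let open_regular A : open A -> regular A.
Proof.
move=> oA e e0; pose F n : set X :=
  \bigcap_(z in ~` A) [set y : X | n.+1%:R^-1 <= mdist z y].
have cF n : closed (F n).
  apply: closed_bigI => z _.
  by move: (@mdistl_continuous _ _ z) => /continuous_closedP/(_ _ (@closed_ge _
    n.+1%:R^-1)).
have FA n : F n `<=` A.
  move=> y Fy; apply: contrapT => Ay; have /= := Fy y Ay.
  by rewrite mdistxx leNgt invr_gt0 ltr0n.
have [|||||n nP] := @measure_exhaust _ (borel X) R P F A _ _ _ _ e.
- by move=> k; exact: closed_borel.
- exact: open_borel.
- move=> i j ij x Fx z Az /=; apply: le_trans (Fx z Az).
  by rewrite lef_pV2 ?posrE// ler_nat.
- move=> x /(open_mball_subset oA)[d d0 dA].
  have [n] := ltr_add_invr d0; rewrite add0r => nd; exists n => // z Az /=.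
  rewrite leNgt; apply/negP => zx; apply: Az; apply: dA.
  by rewrite metric_sym; exact: lt_trans zx nd.
- exact: e0.
by exists (F n), A; split.
Qed.

Let sigma_regular : sigma_algebra setT regular.
Proof.
split.
- by move=> e e0; exists set0, set0; split => //;
    rewrite ?setD0 ?measure0 ?lee_fin ?ltW//; [exact: closed0|exact: open0].
- move=> A rA e /rA[F [U [cF oU FA AU PUF]]]; exists (~` U), (~` F); split.
  + exact: open_closedC.
  + exact: closed_openC.
  + by rewrite setTD; exact: subsetC.
  + by rewrite setTD; exact: subsetC.
  + by rewrite setDE setCK setIC -setDE.
- move=> A rA e e0.
  have eV n : 0 < e / 2 / (2 ^ n.+1)%:R by rewrite !divr_gt0.
  have /choice[F FP] n := rA n _ (eV n).
  have {FP}/choice[U FP] n := FP n.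
  (* An infinite union of closed sets need not be closed, so finitely many [F i] are kept. One half
     of [e] pays for the others, one half for the gaps between [U i] and [F i]. *)
  pose G n := \bigcup_(i in `I_n) F i.
  have cG n : closed (G n) by apply: closed_bigcup => // i _; have [] := FP i.
  have oU : open (\bigcup_n U n) by apply: bigcup_open => i _; have [] := FP i.
  have mF n : measurable (F n : set (borel X)) by apply: closed_borel;
    have [] := FP n.
  have mU n : measurable (U n : set (borel X)) by apply: open_borel;
    have [] := FP n.
  have [|||||n nP] := @measure_exhaust _ (borel X) R P G (\bigcup_n F n) _ _ _
    _ (e / 2).
  + by move=> k; exact: closed_borel.
  + exact: bigcup_measurable.
  + by move=> i j ij x [l /= li xl]; exists l => //=; exact: leq_trans li ij.
  + by move=> x [i _ Fx]; exists i.+1 => //; exists i => //=.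
  + by rewrite divr_gt0.
  exists (G n), (\bigcup_n U n); split => //.
  + by move=> x [i _ Fx]; exists i => //; have [_ _ + _ _] := FP i; apply.
  + by move=> x [i _ Ax]; exists i => //; have [_ _ _ + _] := FP i; apply.
  have h : (P (\bigcup_n (U n `\` F n)) <= (e / 2)%:E)%E.
    apply: measure_bigcup_le; [|by rewrite divr_ge0// ltW|].
      by move=> i; exact: measurableD.
    by move=> i; have [] := FP i.
  rewrite [e in leRHS]splitr EFinD; apply: le_trans (leeD h nP).
  have mD : measurable (\bigcup_n (U n `\` F n) : set (borel X)).
    by apply: bigcup_measurable => i _; exact: measurableD.
  have mE : measurable (\bigcup_n F n `\` G n : set (borel X)).
    by apply: measurableD; [exact: bigcup_measurable|exact: closed_borel].
  apply: le_trans (measureU2 _ mD mE).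
  apply: le_measure; rewrite ?inE//.
  + by apply: measurableD; [exact: open_borel|exact: closed_borel].
  + exact: measurableU.
  + move=> x [[i _ Ux] Gx]; have [Fx|Fx] := pselect ((\bigcup_n F n) x).
      by right.
    by left; exists i => //; split => // Fix; apply: Fx; exists i.
Qed.

Lemma borel_inner_compact : separable X -> forall A : set X,
  measurable (A : set (borel X)) -> forall e : R, 0 < e ->
  exists K : set X, [/\ compact K, K `<=` A & (P (A `\` K) <= e%:E)%E].
Proof.
move=> sX A mA e e0.
have rA : regular A.
  by apply: (smallest_sub sigma_regular) mA => B; exact: open_regular.
have e20 : 0 < e / 2 by rewrite divr_gt0.
have [F [U [cF oU FA AU PUF]]] := rA _ e20.
have [K [cK PK]] := ulam_tight sX e20.
have mK := compact_borel cK; have mF := closed_borel cF.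
exists (K `&` F); split; [exact: compact_closedI | by move=> x [_ /FA]|].
rewrite [e in leRHS]splitr EFinD; apply: le_trans (leeD PK PUF).
have mUF : measurable (U `\` F : set (borel X)).
  by apply: measurableD => //; exact: open_borel.
apply: le_trans (measureU2 _ (measurableC mK) mUF).
apply: le_measure; rewrite ?inE//.
- by apply: measurableD => //; exact: measurableI.
- by apply: measurableU => //; exact: measurableC.
- move=> x [Ax KFx]; have [Kx|] := pselect (K x); last by left.
  by right; split; [exact: AU|move=> Fx; exact: KFx].
Qed.

End tightness.

(** Stated with closed sets instead of subsequences: any cluster point qualifies, also in an
    infinite product, where closed conditions on coordinates are tested. *)
Lemma compact_seq_limit (T : topologicalType) (K : set T) (u : nat -> T) :
  compact K -> (forall n, K (u n)) ->
  exists2 p, K p & forall C : set T, closed C ->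
    (\forall n \near \oo, C (u n)) -> C p.
Proof.
move=> cK Ku.
have [|p [Kp up]] := cK (u @ \oo) _.
  by exists 0%N => // n _; exact: Ku.
exists p => // C cC Cu; apply: cC => B Bp.
by have [y [Cy By]] := up C B Cu Bp; exists y.
Qed.

Lemma markov_ge0 d (T : measurableType d) (R : realType)
    (P : {measure set T -> \bar R}) (g : T -> R) (r : R) :
  measurable_fun setT g -> (forall q, 0 <= g q) -> 0 < r ->
  (r%:E * P [set q | r <= g q]%R <= \int[P]_q (g q)%:E)%E.
Proof.
move=> mg g0 r0.
have := @le_integral_comp_abse _ _ R P setT measurableT (EFin \o g) r id
  (@measurable_id _ _ _) (fun r h => h) (fun _ _ _ _ h => h)
  (iffRL (measurable_EFinP _ _) mg) r0.
rewrite setTI (_ : [set x | _] = [set q | r <= g q]%R); last first.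
  by apply/seteqP; split => q /=; rewrite lee_fin ger0_norm.
move=> /le_trans; apply; rewrite le_eqVlt; apply/orP; left; apply/eqP.
by apply: eq_integral => q _ /=; rewrite ger0_norm.
Qed.

(** * Couplings concentrated near the zero set of a function *)

Section zero_set.
Context {R : realType} {X : completeMetricType R}.
Variables (g : X * X -> R) (h : X * X -> X).
Hypotheses (g0 : forall q, 0 <= g q)
  (mg : measurable_fun setT (g : borel X * borel X -> R))
  (cg : continuous g) (ch : continuous h)
  (mh : measurable_fun setT (h : borel X * borel X -> borel X)).

Lemma zero_set_compact (K F : set X) (r : R) : compact K -> compact F ->
  compact (h @` ((K `*` F) `&` [set q | g q <= r])).
Proof.
move=> cK cF; apply: continuous_compact.
  by apply: continuous_subspaceT => q; exact: ch.
apply: compact_closedI; first exact: compact_setX.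
by move: cg => /continuous_closedP/(_ _ (@closed_le _ r)).
Qed.

(* The sets [g <= 1/n] shrink to [g <= 0], also after projection by [h], because
   [K] and [F] are compact: no optimal coupling is needed, only couplings for
   which the integral of [g] is arbitrarily small. *)
Lemma coupling_zero_set (rho : probability (borel X) R) (K F : set X)
    (a b : \bar R) : compact K -> compact F ->
  (forall e : R, 0 < e -> exists p : probability (borel X * borel X)%type R,
    [/\ (\int[p]_q (g q)%:E <= e%:E)%E,
        (p (~` K `*` setT) <= a)%E, (p (setT `*` ~` F) <= b)%E &
        forall A : set X, measurable (A : set (borel X)) ->
          p (h @^-1` A) = rho A]) ->
  (rho (~` (h @` ((K `*` F) `&` [set q | (g q <= 0)%R]))) <= a + b)%E.
Proof.
move=> cK cF hp; pose E (r : R) := h @` ((K `*` F) `&` [set q | g q <= r]).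
have cE r : compact (E r) by exact: zero_set_compact.
have mE r : measurable (E r : set (borel X)) by exact: compact_borel.
have mK := compact_borel cK; have mF := compact_borel cF.
have Er r : 0 < r -> (rho (~` E r) <= a + b)%E.
  move=> r0; apply/lee_addgt0Pr => e e0.
  (* By Markov, the bound [e * r] on the integral leaves mass at most [e] where [g >= r]. *)
  have [p [pg pK pF ph]] := hp (e * r) (mulr_gt0 e0 r0).
  rewrite -ph; last exact: measurableC.
  pose G := [set q : borel X * borel X | r <= g q].
  have mG : measurable G.
    have := mg measurableT (measurable_itv `[r, +oo[).
    rewrite setTI (_ : _ @^-1` _ = G)//; apply/seteqP.
    by split => q /=; rewrite in_itv/= andbT.
  have pG : (p G <= e%:E)%E.
    rewrite -(@lee_pmul2l _ r%:E)// -EFinM (mulrC r).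
    exact: le_trans (markov_ge0 p mg g0 r0) pg.
  have mKX : measurable (~` K `*` setT : set (borel X * borel X)).
    by apply: measurableX => //; exact: measurableC.
  have mXF : measurable (setT `*` ~` F : set (borel X * borel X)).
    by apply: measurableX => //; exact: measurableC.
  apply: (@le_trans _ _ (p ((~` K `*` setT) `|` (setT `*` ~` F) `|` G))).
    apply: le_measure; rewrite ?inE.
    - rewrite -[X in measurable X]setTI; apply: mh => //; exact: measurableC.
    - by apply: measurableU => //; exact: measurableU.
    - move=> [y z] /= nE.
      have [Ky|] := pselect (K y); last by move=> ?; left; left.
      have [Fz|] := pselect (F z); last by move=> ?; left; right.
      right; rewrite /G /= leNgt; apply/negP => gr.
      by apply: nE; exists (y, z) => //; split => //=; exact: ltW.
  apply: le_trans (measureU2 _ (measurableU _ _ mKX mXF) mG) _.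
  apply: leeD => //; apply: le_trans (measureU2 _ mKX mXF) _.
  exact: leeD.
apply/lee_addgt0Pr => e e0.
have V0 n : 0 < n.+1%:R^-1 :> R by rewrite invr_gt0.
have [||||n nP] := @measure_exhaust _ (borel X) R rho
  (fun n => ~` E n.+1%:R^-1) (~` E 0) _ _ _ _ e e0.
- by move=> n; exact: measurableC.
- exact: measurableC.
- move=> i j ij; apply: subsetC => _ [q [KFq /= gq] <-]; exists q => //.
  by split => //=; apply: le_trans gq _; rewrite lef_pV2 ?posrE// ler_nat.
- move=> x nEx; apply: contrapT => nx.
  (* Otherwise [x] has, for every [n], a preimage with [g <= 1/(n+1)]; a cluster point of these in
     the compact product is a preimage where [g] vanishes. *)
  have /choice[u uP] n : exists q, [/\ (K `*` F) q, g q <= n.+1%:R^-1 & h q =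
    x].
    apply: contrapT => nq; apply: nx; exists n => // -[q [KFq gq] hq].
    by apply: nq; exists q.
  have [q KFq qP] := compact_seq_limit (compact_setX cK cF) (fun n => let: And3
    a _ _ := uP n in a).
  apply: nEx; exists q; last first.
    have cx : closed [set q | h q = x].
      have c1 : closed [set (x : X)] by exact: compact_closed_metric
        (@compact_set1 _ x).
      by move: ch => /continuous_closedP/(_ _ c1).
    by apply: (qP _ cx); near=> n; have [] := uP n.
  split => //=; apply/ler_addgt0Pr => d d0; rewrite add0r.
  have cd : closed [set q | g q <= d].
    by move: cg => /continuous_closedP/(_ _ (@closed_le _ d)).
  apply: (qP _ cd); near=> n => /=; have [_ /le_trans + _] := uP n; apply.
  by apply: ltW; near: n; exact: near_infty_natSinv_lt (PosNum d0).
have mEn : measurable (~` E n.+1%:R^-1 : set (borel X)) by exact: measurableC.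
have mED : measurable (~` E 0 `\` ~` E n.+1%:R^-1 : set (borel X)).
  by apply: measurableD => //; exact: measurableC.
apply: (@le_trans _ _ (rho (~` E n.+1%:R^-1 `|` (~` E 0 `\` ~` E n.+1%:R^-1)))).
  apply: le_measure; rewrite ?inE;
    [exact: measurableC (mE 0)|exact: measurableU mEn mED|].
  by move=> x E0; have [?|?] := pselect ((~` E n.+1%:R^-1) x); [left|right].
by apply: le_trans (measureU2 _ mEn mED) _; apply: leeD => //; exact: Er.
Unshelve. all: by end_near. Qed.

End zero_set.

(** * Wasserstein geodesics issuing from a Dirac mass *)

Section rays.
Context {R : realType} {X : completeMetricType R}.
Variable x0 : X.
Implicit Types (s t : R) (y z : X).

(* Weighted Cauchy-Schwarz defect of [d(x0,z) <= d(x0,y) + d(y,z)]: it is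
   nonnegative, and vanishes iff [y] sits at the fraction [s / t] of a geodesic
   from [x0] to [z]. *)
Definition raygap s t (q : X * X) : R :=
  t / s * mdist x0 q.1 ^+ 2 + t / (t - s) * mdist q.1 q.2 ^+ 2
    - mdist x0 q.2 ^+ 2.

Definition on_ray s t y z : Prop :=
  s * mdist x0 z = t * mdist x0 y /\ t * mdist y z = (t - s) * mdist x0 z.

(** The remainder of Cauchy-Schwarz made explicit: the first term measures the failure of
    proportionality, the second the failure of equality in the triangle inequality. Both are
    nonnegative, so a zero gap annihilates both. *)
Let raygapE s t y z : 0 < s -> s < t -> raygap s t (y, z) =
  ((t - s) * mdist x0 y - s * mdist y z) ^+ 2 / (s * (t - s)) +
  ((mdist x0 y + mdist y z) ^+ 2 - mdist x0 z ^+ 2).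
Proof.
move=> s0 st; rewrite /raygap /=; field.
by apply/andP; split; lra.
Qed.

Let sqr_triangle y z : 0 <= (mdist x0 y + mdist y z) ^+ 2 - mdist x0 z ^+ 2.
Proof.
by rewrite subr_ge0 ler_pXn2r ?nnegrE ?addr_ge0 ?mdist_ge0// metric_triangle.
Qed.

Lemma raygap_ge0 s t q : 0 < s -> s < t -> 0 <= raygap s t q.
Proof.
case: q => y z s0 st; rewrite raygapE// addr_ge0//.
by rewrite divr_ge0 ?sqr_ge0// ltW// mulr_gt0 ?subr_gt0.
Qed.

Lemma raygap_on_ray s t y z : 0 < s -> s < t ->
  raygap s t (y, z) <= 0 -> on_ray s t y z.
Proof.
move=> s0 st; rewrite raygapE// => gap0.
have st0 : 0 < s * (t - s) by rewrite mulr_gt0 ?subr_gt0.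
have h1 : 0 <= ((t - s) * mdist x0 y - s * mdist y z) ^+ 2 / (s * (t - s)).
  by rewrite divr_ge0 ?sqr_ge0// ltW.
have h2 := sqr_triangle y z.
have : ((t - s) * mdist x0 y - s * mdist y z) ^+ 2 / (s * (t - s)) = 0 by lra.
move=> /eqP; rewrite mulf_eq0 invr_eq0 (gt_eqF st0) orbF sqrf_eq0 => /eqP e1.
have : (mdist x0 y + mdist y z) ^+ 2 = mdist x0 z ^+ 2 by lra.
move=> /eqP; rewrite eqrXn2 ?addr_ge0 ?mdist_ge0// => /eqP e2.
by rewrite /on_ray -e2; split; lra.
Qed.

(** The distance from [x] to [z] is squeezed: the path through [y] bounds it from above, the
    triangle inequality for [x0], [x], [z] from below. *)
Lemma on_ray_trans s t u x y z : 0 < s -> s < t -> t < u ->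
  on_ray s t x y -> on_ray t u y z -> on_ray s u x z.
Proof.
move=> s0 st tu [xy1 xy2] [yz1 yz2].
have t0 : 0 < t := lt_trans s0 st.
have e1 : s * mdist x0 z = u * mdist x0 x.
  apply: (mulfI (lt0r_neq0 t0)).
  by rewrite mulrCA yz1 mulrCA xy1 mulrCA.
split => //; apply/eqP; rewrite eq_le; apply/andP; split.
  have /(ler_wpM2l (ltW (mulr_gt0 t0 (lt_trans t0 tu)))) := metric_triangle x y
    z.
  rewrite mulrDr (_ : t * u * mdist x y = u * (t * mdist x y)); last by ring.
  rewrite xy2 (_ : t * u * mdist y z = t * (u * mdist y z)); last by ring.
  rewrite yz2 (_ : u * _ = (t - s) * (u * mdist x0 y)); last by ring.
  rewrite -yz1 -mulrA.
  rewrite (_ : _ + _ = t * ((u - s) * mdist x0 z)); last by ring.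
  by rewrite ler_pM2l.
have /(ler_wpM2l (ltW (lt_trans t0 tu))) := metric_triangle x0 x z.
by rewrite mulrDr -e1; lra.
Qed.

Lemma raygap_continuous s t : continuous (raygap s t).
Proof.
move=> q; rewrite /raygap.
have c1 : {for q, continuous (fun q : X * X => mdist x0 q.1 : R)}.
  apply: (@continuous_comp _ _ _ fst (mdist x0)); first exact: cvg_fst.
  exact: mdistl_continuous.
have c2 : {for q, continuous (fun q : X * X => mdist x0 q.2 : R)}.
  apply: (@continuous_comp _ _ _ snd (mdist x0)); first exact: cvg_snd.
  exact: mdistl_continuous.
have c3 := @mdist_continuous R X q.
apply: cvgB; last by rewrite /=; under eq_fun do rewrite expr2; rewrite expr2;
  apply: cvgM.
by apply: cvgD; apply: cvgMr; under eq_fun do rewrite expr2; rewrite expr2;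
  apply: cvgM.
Qed.

Hypothesis sX : separable X.

Lemma raygap_measurable s t :
  measurable_fun setT (raygap s t : borel X * borel X -> R).
Proof.
have m1 : measurable_fun setT (fun q : borel X * borel X => mdist x0 q.1 : R).
  exact: (measurableT_comp (mdistl_measurable x0) (@measurable_fst _ _ _ _)).
have m2 : measurable_fun setT (fun q : borel X * borel X => mdist x0 q.2 : R).
  exact: (measurableT_comp (mdistl_measurable x0) (@measurable_snd _ _ _ _)).
apply: measurable_funB; last exact: measurable_funX.
apply: measurable_funD; apply: measurable_funM => //;
  apply: measurable_funX => //.
exact: mdist_measurable.
Qed.

End rays.

Section wasserstein.
Context {R : realType} {X : completeMetricType R}.
Hypothesis sX : separable X.
Implicit Types (mu nu : probability (borel X) R)
  (p : probability (borel X * borel X)%type R) (x : X).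
Local Open Scope ereal_scope.

Lemma coupling_fst mu nu p (f : X -> \bar R) : coupling mu nu p ->
  measurable_fun setT (f : borel X -> \bar R) -> (forall y, 0 <= f y) ->
  \int[p]_q f q.1 = \int[mu]_y f y.
Proof.
move=> cp mf f0.
have mfst := @measurable_fst _ _ (borel X) (borel X).
have /= <- := @ge0_integral_pushforward _ _ _ _ R _ mfst p setT f measurableT
  mf (fun y _ => f0 y).
apply: eq_measure_integral => A mA _; apply: eq_trans (cp A mA).1.
rewrite /= /pushforward; congr (p _).
by apply/seteqP; split => -[y z]//= -[].
Qed.

Lemma coupling_snd mu nu p (f : X -> \bar R) : coupling mu nu p ->
  measurable_fun setT (f : borel X -> \bar R) -> (forall y, 0 <= f y) ->
  \int[p]_q f q.2 = \int[nu]_y f y.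
Proof.
move=> cp mf f0.
have msnd := @measurable_snd _ _ (borel X) (borel X).
have /= <- := @ge0_integral_pushforward _ _ _ _ R _ msnd p setT f measurableT
  mf (fun y _ => f0 y).
apply: eq_measure_integral => A mA _; apply: eq_trans (cp A mA).2.
rewrite /= /pushforward; congr (p _).
by apply/seteqP; split => -[y z]//= -[].
Qed.

Lemma coupling_ex mu nu : exists p, coupling mu nu p.
Proof.
exists (mu \x nu) => A mA; split.
  apply: eq_trans (product_measure1E mu nu mA measurableT) _.
  by rewrite [X in _ * X](probability_setT nu) mule1.
apply: eq_trans (product_measure1E mu nu measurableT mA) _.
by rewrite [X in X * _](probability_setT mu) mul1e.
Qed.

Lemma measurable_sqr_mdist x :
  measurable_fun setT (fun y : borel X => ((mdist x y) ^+ 2)%:E : \bar R).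
Proof.
by apply/measurable_EFinP; apply: measurable_funX; exact: mdistl_measurable.
Qed.

(** Such a coupling charges only {x} x X, so its cost is forced, and the infimum defining [W2] from
    a Dirac mass runs over a single value. *)
Lemma coupling_dirac mu nu p x : eq_meas mu (\d_(x : borel X)) -> coupling mu
    nu p ->
  \int[p]_q ((mdist q.1 q.2) ^+ 2)%:E = \int[nu]_y ((mdist x y) ^+ 2)%:E.
Proof.
move=> mux cp; rewrite -(coupling_snd cp (measurable_sqr_mdist x)); last first.
  by move=> y; rewrite lee_fin sqr_ge0.
apply: ae_eq_integral => //.
- by apply/measurable_EFinP; apply: measurable_funX; exact: mdist_measurable.
- exact: (measurableT_comp (measurable_sqr_mdist x) (@measurable_snd _ _ _ _)).
exists ((~` [set x]) `*` setT); split.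
- apply: measurableX => //; apply: measurableC; apply: compact_borel.
  exact: compact_set1.
- have mx : measurable (~` [set x] : set (borel X)).
    by apply: measurableC; apply: compact_borel; exact: compact_set1.
  apply: eq_trans (cp _ mx).1 _; apply: eq_trans (mux _ mx) _.
  by rewrite /= /dirac indicE memNset//= => /(_ erefl).
- move=> [y z] /= nyz; split => // yx; apply: nyz => _; by rewrite yx.
Qed.

Lemma W2_dirac mu nu x : eq_meas mu (\d_(x : borel X)) ->
  W2 mu nu = poweR (\int[nu]_y ((mdist x y) ^+ 2)%:E) 2^-1.
Proof.
move=> mux; rewrite /W2 (_ : [set _ | _ in _] =
    [set \int[nu]_y ((mdist x y) ^+ 2)%:E]) ?ereal_inf1//.
apply/seteqP; split => [_ [p cp <-]|_ ->]; first exact: (coupling_dirac mux cp).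
by have [p cp] := coupling_ex mu nu; exists p => //;
  exact: (coupling_dirac mux cp).
Qed.

Lemma poweR_half_inj (a : \bar R) (r : R) : 0 <= a -> (0 <= r)%R ->
  poweR a 2^-1 = r%:E -> a = (r ^+ 2)%:E.
Proof.
case: a => [a| |]//; last by rewrite poweRyr// invr_eq0 pnatr_eq0.
rewrite lee_fin poweR_EFin => a0 r0 [<-].
by rewrite powR12_sqrt// sqr_sqrtr.
Qed.

Lemma ge0_integral_sqr_mdist mu x : 0 <= \int[mu]_y ((mdist x y) ^+ 2)%:E.
Proof. by apply: integral_ge0 => y _; rewrite lee_fin sqr_ge0. Qed.

Section geodesic_from_dirac.
Variables (x : X) (mu : R -> probability (borel X) R).
Hypotheses (mu_geo : W2_geodesic mu) (mu0 : eq_meas (mu 0%R) (\d_(x : borel X)))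
  (mu1 : \int[mu 1%R]_y ((mdist x y) ^+ 2)%:E < +oo).

(** [c] is the W_2-distance between the endpoints, and the moments are squared distances to the
    initial Dirac mass. The slack [e] replaces attainment of the infimum. *)
Lemma W2_geodesic_coupling : exists2 c : R, (0 <= c)%R &
  (forall t, t \in `[0%R, 1%R] ->
    \int[mu t]_y ((mdist x y) ^+ 2)%:E = ((t * c) ^+ 2)%:E) /\
  (forall s t e, s \in `[0%R, 1%R] -> t \in `[0%R, 1%R] -> (s < t)%R -> (0 <
    e)%R ->
    exists p, coupling (mu s) (mu t) p /\
      \int[p]_q ((mdist q.1 q.2) ^+ 2)%:E <= (((t - s) * c) ^+ 2 + e)%:E).
Proof.
have I1 : (1%R : R) \in `[0%R, 1%R] by rewrite in_itv/= ler01 lexx.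
have I0 : (0%R : R) \in `[0%R, 1%R] by rewrite in_itv/= ler01 lexx.
have fin1 : \int[mu 1%R]_y ((mdist x y) ^+ 2)%:E \is a fin_num.
  by rewrite ge0_fin_numE// ge0_integral_sqr_mdist.
pose c := Num.sqrt (fine (\int[mu 1%R]_y ((mdist x y) ^+ 2)%:E)).
have c0 : (0 <= c)%R by exact: sqrtr_ge0.
have W1 : W2 (mu 0%R) (mu 1%R) = c%:E.
  rewrite (W2_dirac _ mu0) -(fineK fin1) poweR_EFin powR12_sqrt//.
  exact/fine_ge0/ge0_integral_sqr_mdist.
exists c => //; split=> [t t01|s t e s01 t01 st e0].
  move: (t01); rewrite in_itv/= => /andP[t0 _].
  apply: poweR_half_inj; [exact: ge0_integral_sqr_mdist|exact: mulr_ge0|].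
  by rewrite -(W2_dirac _ mu0) mu_geo// W1 sub0r normrN ger0_norm.
have W2st : W2 (mu s) (mu t) = ((t - s) * c)%:E.
  by rewrite mu_geo// W1 distrC ger0_norm// subr_ge0 ltW.
have /lb_ereal_inf_adherent-/(_ _ e0)[_ [p cp <-] pe] :
    ereal_inf [set \int[p]_q ((mdist q.1 q.2) ^+ 2)%:E | p in coupling (mu s)
      (mu t)]
      \is a fin_num.
  rewrite (poweR_half_inj _ _ W2st)//.
    by apply: le_ereal_inf_tmp => _ [p _ <-]; apply: integral_ge0 => q _;
      rewrite lee_fin sqr_ge0.
  by rewrite mulr_ge0// subr_ge0 ltW.
exists p; split => //; apply: ltW; apply: lt_le_trans pe _.
rewrite (poweR_half_inj _ _ W2st) ?EFinD//.
  by apply: le_ereal_inf_tmp => _ [p' _ <-]; apply: integral_ge0 => q _;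
    rewrite lee_fin sqr_ge0.
by rewrite mulr_ge0// subr_ge0 ltW.
Qed.

(** Moments [(s c)^2], [(t c)^2] and cost [((t - s) c)^2] contribute
    [t s c^2 + t (t - s) c^2 - t^2 c^2 = 0] to the integrated gap, so only the slack of the coupling
    remains. *)
Lemma raygap_coupling s t e : (0 < s)%R -> (s < t)%R -> (t <= 1)%R -> (0 < e)%R
    ->
  exists p, coupling (mu s) (mu t) p /\ \int[p]_q (raygap x s t q)%:E <= e%:E.
Proof.
move=> s0 st t1 e0; have t0 : (0 < t)%R := lt_trans s0 st.
have [c c0 [cmom ccoup]] := W2_geodesic_coupling.
have s01 : s \in `[0%R, 1%R] by rewrite in_itv/=; apply/andP; split; lra.
have t01 : t \in `[0%R, 1%R] by rewrite in_itv/=; apply/andP; split; lra.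
have ts0 : (0 < t - s)%R by rewrite subr_gt0.
(* The cost enters the gap with weight [t / (t - s)], which this slack compensates. *)
have k0 : (0 < e * ((t - s) / t))%R by rewrite !mulr_gt0// invr_gt0.
have [p [cp pd]] := ccoup s t _ s01 t01 st k0.
exists p; split => //.
have m1 : measurable_fun setT (fun q : borel X * borel X => (mdist x q.1 ^+
  2)%:E : \bar R).
  exact: (measurableT_comp (measurable_sqr_mdist x) (@measurable_fst _ _ _ _)).
have m2 : measurable_fun setT (fun q : borel X * borel X => (mdist x q.2 ^+
  2)%:E : \bar R).
  exact: (measurableT_comp (measurable_sqr_mdist x) (@measurable_snd _ _ _ _)).
have m3 : measurable_fun setT (fun q : borel X * borel X => (mdist q.1 q.2 ^+
  2)%:E : \bar R).
  by apply/measurable_EFinP; apply: measurable_funX; exact: mdist_measurable.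
have ts : (0 <= t / s)%R by rewrite divr_ge0// ltW.
have tts : (0 <= t / (t - s))%R by rewrite divr_ge0// ltW.
have sq0 (y z : X) : 0 <= ((mdist y z) ^+ 2)%:E :> \bar R by rewrite lee_fin
  sqr_ge0.
(* The negative term of the gap is moved to the left, so that only integrals of nonnegative
   functions are split. *)
have e1 : \int[p]_q (raygap x s t q)%:E + ((t * c) ^+ 2)%:E =
    (t / s)%:E * ((s * c) ^+ 2)%:E +
    (t / (t - s))%:E * \int[p]_q ((mdist q.1 q.2) ^+ 2)%:E.
  rewrite -(cmom _ t01) -(cmom _ s01) -(coupling_snd cp (measurable_sqr_mdist
    x))//.
  rewrite -(coupling_fst cp (measurable_sqr_mdist x))//.
  rewrite -!ge0_integralZl_EFin// -!ge0_integralD//.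
  - by apply: eq_integral => q _; rewrite -!EFinM -!EFinD /raygap subrK.
  - by move=> q _; rewrite mule_ge0.
  - exact: measurable_funeM.
  - by move=> q _; rewrite mule_ge0.
  - exact: measurable_funeM.
  - by move=> q _; rewrite lee_fin raygap_ge0.
  - by apply/measurable_EFinP; exact: raygap_measurable.
rewrite -(@leeD2rE _ ((t * c) ^+ 2)%:E)// e1.
have tts' : 0 <= (t / (t - s))%:E by rewrite lee_fin.
apply: le_trans (leeD (lexx _) (lee_wpmul2l tts' pd)) _.
rewrite -!EFinM -!EFinD lee_fin le_eqVlt; apply/orP; left; apply/eqP.
by field; apply/and3P; split; lra.
Qed.

(** Used with [h = fst], [r = s] and with [h = snd], [r = t]. *)
Lemma ray_step (h : X * X -> X) s t (r : R) (K F : set X) : continuous h ->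
  measurable_fun setT (h : borel X * borel X -> borel X) ->
  (0 < s)%R -> (s < t)%R -> (t <= 1)%R -> compact K -> compact F ->
  (forall p, coupling (mu s) (mu t) p -> forall A : set X,
    measurable (A : set (borel X)) -> p (h @^-1` A) = mu r A) ->
  mu r (~` (h @` ((K `*` F) `&` [set q | (raygap x s t q <= 0)%R]))) <=
    mu s (~` K) + mu t (~` F).
Proof.
move=> ch mh s0 st t1 cK cF hr.
apply: (@coupling_zero_set _ _ (raygap x s t) h) => //.
- by move=> q; exact: raygap_ge0.
- exact: raygap_measurable.
- exact: raygap_continuous.
move=> e e0; have [p [cp pe]] := raygap_coupling s0 st t1 e0.
exists p; split => //.
- have mK : measurable (~` K : set (borel X)) by apply: measurableC;
    exact: compact_borel.
  by have := (cp _ mK).1 => ->.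
- have mF : measurable (~` F : set (borel X)) by apply: measurableC;
    exact: compact_borel.
  by have := (cp _ mF).2 => ->.
- exact: hr.
Qed.

(** Points of [K], at time [s], from which a point of [F] is reached at time [t] along a ray. They
    form a compact set when [K] and [F] are compact, so the operation can be iterated. *)
Definition ray_pred s t (K F : set X) : set X :=
  fst @` ((K `*` F) `&` [set q | (raygap x s t q <= 0)%R]).

Definition ray_succ s t (K F : set X) : set X :=
  snd @` ((K `*` F) `&` [set q | (raygap x s t q <= 0)%R]).

Lemma ray_predP s t K F : (0 < s)%R -> (s < t)%R -> (t <= 1)%R ->
  compact K -> compact F -> compact (ray_pred s t K F) /\
  mu s (~` ray_pred s t K F) <= mu s (~` K) + mu t (~` F).
Proof.
move=> s0 st t1 cK cF; split.
  by apply: zero_set_compact => //; [exact: raygap_continuous|move=> q;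
    exact: cvg_fst].
apply: ray_step => //; first by move=> q; exact: cvg_fst.
move=> p cp A mA; rewrite -(cp A mA).1; congr (p _).
by apply/seteqP; split => -[y z]//= -[].
Qed.

Lemma ray_succP s t K F : (0 < s)%R -> (s < t)%R -> (t <= 1)%R ->
  compact K -> compact F -> compact (ray_succ s t K F) /\
  mu t (~` ray_succ s t K F) <= mu s (~` K) + mu t (~` F).
Proof.
move=> s0 st t1 cK cF; split.
  by apply: zero_set_compact => //; [exact: raygap_continuous|move=> q;
    exact: cvg_snd].
apply: ray_step => //; first by move=> q; exact: cvg_snd.
move=> p cp A mA; rewrite -(cp A mA).2; congr (p _).
by apply/seteqP; split => -[y z]//= -[].
Qed.

End geodesic_from_dirac.

End wasserstein.

(** * Geodesics recovered from their rational times *)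

Section extension.
Context {R : realType} {X : completeMetricType R}.

Lemma rat_approx (u e : R) : 0 <= u <= 1 -> 0 < e ->
  exists q : rat, 0 <= (ratr q : R) <= 1 /\ `|u - ratr q| < e.
Proof.
move=> /andP[u0 u1] e0.
have : Num.max 0 (u - e) < Num.min 1 (u + e).
  by rewrite gt_max !lt_min; apply/andP; split; apply/andP; split; lra.
move=> /rat_in_itvoo[q]; rewrite in_itv/= gt_max lt_min.
move=> /andP[/andP[q0 qe] /andP[q1 eq]]; exists q; split; first by rewrite !ltW.
by rewrite ltr_norml; apply/andP; split; lra.
Qed.

Lemma vanishing_seq : exists dl : nat -> R, [/\ forall n, 0 < dl n,
  forall n m, (n <= m)%N -> dl m <= dl n & forall e, 0 < e -> exists n, dl n <
    e].
Proof.
exists (fun n => n.+1%:R^-1); split=> [n|n m nm|e e0].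
- by rewrite invr_gt0.
- by rewrite lef_pV2 ?posrE// ler_nat.
- by have [n] := ltr_add_invr e0; rewrite add0r; exists n.
Qed.

(** Up to the factor [v], [W] is isometric on rational times, hence Cauchy along rationals tending
    to a real time; completeness provides the value there. *)
Lemma rat_geodesic_extension (W : rat -> X) (v : R) : 0 <= v ->
  (forall q r : rat, 0 <= (ratr q : R) <= 1 -> 0 <= (ratr r : R) <= 1 ->
    mdist (W q) (W r) = `|ratr q - ratr r| * v) ->
  exists2 g : R -> X, geodesic g &
    forall q : rat, 0 <= (ratr q : R) <= 1 -> g (ratr q) = W q.
Proof.
move=> v0 Wd; have [dl [dl0 dlm dlsmall]] := vanishing_seq.
(* Upper bounds on the distances to all [W q] already pin the value down; exact distances follow
   from them by triangle inequalities. *)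
have ex u : exists z : X, 0 <= u <= 1 -> forall q : rat, 0 <= (ratr q : R) <= 1
  ->
    mdist (W q) z <= `|u - ratr q| * v.
  have [u01|] := boolP (0 <= u <= 1); last by exists (W 0).
  have /choice[q qP] n := rat_approx u01 (dl0 n).
  have cW : cauchy_ex ((W \o q) @ \oo).
    move=> r r0; have rv : 0 < r / (2 * v + 1) by rewrite divr_gt0// ltr_wpDl//
      mulr_ge0.
    have [N] := dlsmall _ rv; rewrite ltr_pdivlMr ?ltr_wpDl ?mulr_ge0// => Nr.
    exists (W (q N)); exists N => // n /= Nn; rewrite ballEmdist/=.
    have [q01N qN] := qP N; have [q01n qn] := qP n.
    have nN := dlm _ _ Nn.
    have h : `|ratr (q N) - ratr (q n)| <= 2 * dl N :> R.
      have -> : ratr (q N) - ratr (q n) = (u - ratr (q n)) - (u - ratr (q N))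
        :> R by lra.
      apply: le_trans (ler_normB _ _) _; lra.
    have /= h2 := ler_wpM2r v0 h; have dN := dl0 N; rewrite Wd//; nra.
  have [z Wz] : exists z : X, (W \o q) @ \oo --> z.
    by apply/cvg_ex; exact: (@cauchy_cvg X _ _ (cauchy_exP _ cW)).
  exists z => _ p p01; apply/ler_addgt0Pr => e e0.
  have cC := @closed_mball R X (W p) (`|u - ratr p| * v + e).
  suff nearW : \forall n \near \oo, mdist (W p) ((W \o q) n) <= `|u - ratr p| *
    v + e.
    exact: (closed_cvg (fun z => mdist (W p) z <= `|u - ratr p| * v + e) cC
      nearW _ Wz).
  have ev : 0 < e / (v + 1) by rewrite divr_gt0// ltr_wpDl.
  have [N] := dlsmall _ ev; rewrite ltr_pdivlMr ?ltr_wpDl// => Ne.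
  exists N => // n /= Nn; have [q01n qn] := qP n.
  rewrite Wd//.
  have nN := dlm _ _ Nn.
  have -> : ratr p - ratr (q n) = (u - ratr (q n)) - (u - ratr p) by lra.
  apply: le_trans (ler_wpM2r v0 (ler_normB _ _)) _.
  have h : `|u - ratr (q n)| <= dl N by lra.
  have /= h2 := ler_wpM2r v0 h; have dN := dl0 N; nra.
have [g gP] := choice ex.
have gW q : 0 <= (ratr q : R) <= 1 -> g (ratr q) = W q.
  move=> q01; apply/esym/mdist_positivity/eqP; rewrite eq_le mdist_ge0 andbT.
  by have := gP _ q01 _ q01; rewrite subrr normr0 mul0r.
have gd s t : 0 <= s <= 1 -> 0 <= t <= 1 -> mdist (g s) (g t) = `|s - t| * v.
  move=> s01 t01; apply/eqP; rewrite -subr_eq0 -normr_le0;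
    apply/ler_addgt0Pr => e e0.
  (* Each of the two rational approximations is paid for twice, at rate [v]; the [+ 1] covers
     [v = 0]. *)
  rewrite add0r; have ev : 0 < e / (4 * v + 1) by rewrite divr_gt0// ltr_wpDl//
    mulr_ge0.
  have [q [q01 qs]] := rat_approx s01 ev;
    have [r [r01 rt]] := rat_approx t01 ev.
  have h1 := gP _ s01 _ q01; have h2 := gP _ t01 _ r01;
    have h3 := Wd _ _ q01 r01.
  have b1 := ler_wpM2r v0 (ltW qs); have b2 := ler_wpM2r v0 (ltW rt).
  have d1 := metric_triangle (g s) (W q) (g t);
    rewrite (metric_sym (g s) (W q)) in d1.
  have d2 := metric_triangle (W q) (W r) (g t).
  have d3 := metric_triangle (W q) (g s) (W r).
  have d4 := metric_triangle (g s) (g t) (W r);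
    rewrite (metric_sym (g t) (W r)) in d4.
  have e4 : 4 * (e / (4 * v + 1) * v) <= e.
    have k0 : 0 < 4 * v + 1 by rewrite ltr_wpDl// mulr_ge0.
    have ek := divfK (lt0r_neq0 k0) e; nra.
  have n1 : `|ratr q - ratr r| * v <= `|s - t| * v + `|s - ratr q| * v + `|t -
    ratr r| * v.
    rewrite -!mulrDl ler_wpM2r//.
    have -> : ratr q - ratr r = (s - t) - (s - ratr q) + (t - ratr r) :> R by
      lra.
    apply: le_trans (ler_normD _ _) _; rewrite lerD2r; exact: ler_normB.
  have n2 : `|s - t| * v <= `|ratr q - ratr r| * v + `|s - ratr q| * v + `|t -
    ratr r| * v.
    rewrite -!mulrDl ler_wpM2r//.
    have -> : s - t = (ratr q - ratr r) + (s - ratr q) - (t - ratr r) :> R by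
      lra.
    apply: le_trans (ler_normB _ _) _; rewrite lerD2r; exact: ler_normD.
  rewrite ler_norml; apply/andP; split; lra.
exists g => // s t; rewrite !in_itv/= => s01 t01.
by rewrite !gd ?lexx ?ler01// sub0r normrN normr1 mul1r.
Qed.

End extension.

(** * Chains of points along finitely many rational times *)

Section chains.
Context {R : realType} {X : completeMetricType R}.
Hypothesis sX : separable X.
Variables (x : X) (mu : R -> probability (borel X) R).
Hypotheses (mu_geo : W2_geodesic mu) (mu0 : eq_meas (mu 0) (\d_(x : borel X)))
  (mu1 : (\int[mu 1%R]_y ((mdist x y) ^+ 2)%:E < +oo)%E).
Variable K : rat -> set X.
Hypothesis cK : forall q, compact (K q).
Implicit Types (q r t u : rat) (l : seq rat).

Local Notation ray q r := (on_ray x (ratr q : R) (ratr r)).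

(* The lists of times are increasing in [chain_up] and decreasing in
   [chain_down]. Propagating sets of good points one time step at a time
     replaces
   the gluing of the couplings. *)
Fixpoint chain_up t l : set X :=
  if l is u :: l' then ray_pred x (ratr t) (ratr u) (K t) (chain_up u l') else
    K t.

Fixpoint chain_down t l : set X :=
  if l is u :: l' then ray_succ x (ratr u) (ratr t) (chain_down u l') (K t)
    else K t.

(** Each step carries the mass already lost over to the next time and adds the loss of one more
    [K q]. Every time is counted once, so summable losses give a bound independent of the list. *)
Lemma chain_upP t l : 0 < t -> path <%R t l -> all (<= 1) l -> compact
    (chain_up t l) /\
  (mu (ratr t) (~` chain_up t l) <= \sum_(q <- t :: l) mu (ratr q) (~` K q))%E.
Proof.
elim: l t => [|u l IH] t t0 /= tl l1; first by rewrite big_seq1; split.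
move: tl l1 => /andP[tu ul] /andP[u1 l1].
have [cu hu] := IH u (lt_trans t0 tu) ul l1.
have [|||cp hp] := @ray_predP _ _ sX x mu mu_geo mu0 mu1 (ratr t) (ratr u) (K
  t) _ _ _ _ (@cK t) cu.
- by rewrite ltr0q.
- by rewrite ltr_rat.
- by rewrite -(rmorph1 (@ratr R)) ler_rat.
split => //; apply: le_trans hp _; rewrite [leRHS]big_cons.
exact: leeD.
Qed.

Lemma chain_downP t l : t <= 1 -> path >%R t l -> all (> 0) l -> compact
    (chain_down t l) /\
  (mu (ratr t) (~` chain_down t l) <= \sum_(q <- t :: l) mu (ratr q) (~` K
    q))%E.
Proof.
elim: l t => [|u l IH] t t1 /= tl l0; first by rewrite big_seq1; split.
move: tl l0 => /andP[tu ul] /andP[u0 l0].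
have [cu hu] := IH u (le_trans (ltW tu) t1) ul l0.
have [|||cp hp] := @ray_succP _ _ sX x mu mu_geo mu0 mu1 (ratr u) (ratr t) _ _
  _ _ _ cu (@cK t).
- by rewrite ltr0q.
- by rewrite ltr_rat.
- by rewrite -(rmorph1 (@ratr R)) ler_rat.
split => //; apply: le_trans hp _; rewrite [leRHS]big_cons addeC.
exact: leeD.
Qed.

Lemma ratr_on_ray_trans q r u y z w : 0 < q -> q < r -> r < u ->
  ray q r y z -> ray r u z w -> ray q u y w.
Proof. by move=> q0 qr ru; apply: on_ray_trans; rewrite ?ltr0q ?ltr_rat. Qed.

Lemma raygap_ray q r y z : 0 < q -> q < r ->
  raygap x (ratr q) (ratr r) (y, z) <= 0 -> ray q r y z.
Proof. by move=> q0 qr; apply: raygap_on_ray; rewrite ?ltr0q ?ltr_rat. Qed.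

(** The construction links only consecutive times; transitivity of rays links all pairs. *)
Lemma chain_up_ray t l y : 0 < t -> path <%R t l -> chain_up t l y ->
  exists w : rat -> X, [/\ w t = y, forall q, q \in t :: l -> K q (w q) &
    forall q r, q \in t :: l -> r \in t :: l -> q < r -> ray q r (w q) (w r)].
Proof.
elim: l t y => [|u l IH] t y t0.
  move=> _ Ky; exists (fun=> y); split => // q; first by rewrite inE => /eqP->.
  by move=> r; rewrite !inE => /eqP-> /eqP->; rewrite ltxx.
move=> /= /andP[tu ul] [[y' z] [[/= Ky uz] gap] /= yy];
  rewrite {}yy in Ky gap *.
have [w [wz wK wray]] := IH u z (lt_trans t0 tu) ul uz.
have tz := raygap_ray t0 tu gap.
have lt_l q : q \in u :: l -> t < q.
  have /allP := order_path_min (@lt_trans _ _) ul.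
  by rewrite inE => ulP /orP[/eqP->//|/ulP]; exact: lt_trans.
have u_l q : q \in u :: l -> q = u \/ u < q.
  have /allP := order_path_min (@lt_trans _ _) ul.
  by rewrite inE => ulP /orP[/eqP->|/ulP]; [left|right].
pose w' q := if q == t then y else w q.
have w'w q : q \in u :: l -> w' q = w q.
  by move=> /lt_l tq; rewrite /w' gt_eqF.
have w't : w' t = y by rewrite /w' eqxx.
exists w'; split => // q.
  rewrite in_cons => /orP[/eqP->|ql]; first by rewrite w't.
  by rewrite w'w//; exact: wK.
move=> r; rewrite in_cons => /orP[/eqP->|ql];
  rewrite in_cons => /orP[/eqP->|rl] qr.
- by rewrite ltxx in qr.
- rewrite w't w'w//; have [ru|ur] := u_l r rl; first by rewrite ru wz.
  by apply: (ratr_on_ray_trans t0 tu ur tz); rewrite -wz; apply: wray => //;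
    rewrite mem_head.
- by have := lt_trans qr (lt_l q ql); rewrite ltxx.
- by rewrite !w'w//; exact: wray.
Qed.

Lemma chain_down_ray t l y : path >%R t l -> all (> 0) l -> chain_down t l y ->
  exists w : rat -> X, [/\ w t = y, forall q, q \in t :: l -> K q (w q) &
    forall q r, q \in t :: l -> r \in t :: l -> q < r -> ray q r (w q) (w r)].
Proof.
elim: l t y => [|u l IH] t y.
  move=> _ _ Ky; exists (fun=> y); split => // q;
    first by rewrite inE => /eqP->.
  by move=> r; rewrite !inE => /eqP-> /eqP->; rewrite ltxx.
move=> /= /andP[tu ul] /andP[u0 l0] [[z y'] [[/= uz Ky] gap] /= yy];
  rewrite {}yy in Ky gap *.
have [w [wz wK wray]] := IH u z ul l0 uz.
have tz := raygap_ray u0 tu gap.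
have u_l q : q \in u :: l -> q = u \/ q < u.
  have /allP := order_path_min (rev_trans (@lt_trans _ rat)) ul.
  by rewrite inE => ulP /orP[/eqP->|/ulP]; [left|right].
have lt_l q : q \in u :: l -> q < t.
  by move=> /u_l[->//|] /lt_trans; apply.
pose w' q := if q == t then y else w q.
have w'w q : q \in u :: l -> w' q = w q.
  by move=> /lt_l tq; rewrite /w' lt_eqF.
have w't : w' t = y by rewrite /w' eqxx.
exists w'; split => // q.
  rewrite in_cons => /orP[/eqP->|ql]; first by rewrite w't.
  by rewrite w'w//; exact: wK.
move=> r; rewrite in_cons => /orP[/eqP->|ql];
  rewrite in_cons => /orP[/eqP->|rl] qr.
- by rewrite ltxx in qr.
- by have := lt_trans qr (lt_l r rl); rewrite ltxx.
- rewrite w't w'w//; have [qu|uq] := u_l q ql; first by rewrite qu wz.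
  have q0 : 0 < q by move: ql; rewrite inE => /orP[/eqP->//|/(allP l0)].
  by apply: (ratr_on_ray_trans q0 uq tu _ tz); rewrite -wz; apply: wray => //;
    rewrite mem_head.
- by rewrite !w'w//; exact: wray.
Qed.

(** Both chains pass through the same point [y] at time [t], and two times on different sides of [t]
    are linked through it. *)
Lemma chain_ray t lu ld y : 0 < t -> path <%R t lu -> path >%R t ld -> all (>
    0) ld ->
  (chain_up t lu `&` chain_down t ld) y ->
  exists w : rat -> X, [/\ w t = y, forall q, q \in t :: lu ++ ld -> K q (w q) &
    forall q r, q \in t :: lu ++ ld -> r \in t :: lu ++ ld -> q < r -> ray q r
      (w q) (w r)].
Proof.
move=> t0 tlu tld ld0 [yu yd].
have [wu [wut wuK wur]] := chain_up_ray t0 tlu yu.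
have [wd [wdt wdK wdr]] := chain_down_ray tld ld0 yd.
have luP := order_path_min (@lt_trans _ _) tlu.
have ldP := order_path_min (rev_trans (@lt_trans _ rat)) tld.
pose w q := if q < t then wd q else wu q.
have memP q : q \in t :: lu ++ ld -> (q < t /\ q \in ld) \/ (t <= q /\ q \in t
  :: lu).
  rewrite in_cons mem_cat => /orP[/eqP->|/orP[ql|ql]].
  - by right; rewrite mem_head.
  - by right; rewrite in_cons ql orbT ltW//; exact: (allP luP).
  - by left; split => //; exact: (allP ldP).
have wuE q : t <= q -> w q = wu q by rewrite /w ltNge => ->.
have wdE q : q < t -> w q = wd q by rewrite /w => ->.
exists w; split; first by rewrite wuE.
- move=> q /memP[[qt ql]|[tq ql]]; first by rewrite wdE//; apply: wdK;
    rewrite in_cons ql orbT.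
  by rewrite wuE//; exact: wuK.
move=> q r /memP[[qt ql]|[tq ql]] /memP[[rt rl]|[tr rl]] qr.
- by rewrite !wdE//; apply: wdr => //; rewrite in_cons ?ql ?rl orbT.
- have qtr : ray q t (wd q) y.
    by rewrite -wdt; apply: wdr => //; rewrite in_cons ?ql ?eqxx ?orbT.
  rewrite wdE// wuE//; move: tr; rewrite le_eqVlt => /orP[/eqP<-|tr];
    first by rewrite wut.
  apply: (ratr_on_ray_trans _ qt tr qtr); first exact: (allP ld0).
  by rewrite -wut; apply: wur => //; rewrite mem_head.
- by have := lt_le_trans rt (le_trans tq (ltW qr)); rewrite ltxx.
- by rewrite !wuE//; exact: wur.
Qed.

End chains.

(** * Mass carried by the intermediate points *)

(** The weight of [q] depends on its code alone, so one choice of the sets [K q] serves all finite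
    lists of times. *)
Lemma sum_pickle_le (R : realType) (T : countType) (e : R) (l : seq T) :
  0 <= e -> uniq l -> (\sum_(q <- l) (e / (2 ^ (pickle q).+1)%:R)%:E <= e%:E)%E.
Proof.
move=> e0 ul; pose F (i : nat) : \bar R := (e / (2 ^ i.+1)%:R)%:E.
have F0 i : (0 <= F i)%E by rewrite lee_fin divr_ge0.
pose s := map pickle l; have us : uniq s by rewrite map_inj_uniq//;
  exact: (pcan_inj pickleK).
rewrite (_ : (\sum_(q <- l) _)%E = (\sum_(i <- s) F i)%E);
  last by rewrite big_map.
have [N sN] : exists N, forall i, i \in s -> (i < N)%N.
  by exists (\max_(i <- s) i).+1 => i si; rewrite ltnS;
    exact: (leq_bigmax_seq i si isT).
apply: (@le_trans _ _ (\sum_(0 <= i < N) F i)%E).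
  rewrite (perm_big [seq i <- index_iota 0 N | i \in s]) /=; last first.
    apply: uniq_perm => //; first by rewrite filter_uniq// iota_uniq.
    move=> i; rewrite mem_filter mem_index_iota /=.
    by case: (boolP (i \in s)) => // /sN ->.
  by rewrite big_filter; apply: lee_sum_nneg_subset => // i _ _; exact: F0.
apply: le_trans (epsilon_trick0 xpredT e0).
exact: nneseries_lim_ge.
Qed.

Section intermediate_mass.
Context {R : realType} {X : completeMetricType R}.
Hypothesis sX : separable X.
Variables (x : X) (mu : R -> probability (borel X) R).
Hypotheses (mu_geo : W2_geodesic mu) (mu0 : eq_meas (mu 0) (\d_(x : borel X)))
  (mu1 : (\int[mu 1%R]_y ((mdist x y) ^+ 2)%:E < +oo)%E).

Local Notation ray q r := (on_ray x (ratr q : R) (ratr r)).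

(** Since [raygap] is continuous, this exhibits lying on a ray as a closed condition, which survives
    limits. *)
Lemma raygapP (s t : R) (y z : X) : 0 < s -> s < t ->
  on_ray x s t y z <-> raygap x s t (y, z) <= 0.
Proof.
move=> s0 st; split; last exact: raygap_on_ray.
move=> [e1 e2]; have t0 := lt_trans s0 st.
have h1 : mdist x y = s / t * mdist x z.
  by apply: (mulfI (lt0r_neq0 t0));
    rewrite -e1 mulrA mulrCA mulfV ?gt_eqF// mulr1.
have h2 : mdist y z = (t - s) / t * mdist x z.
  by apply: (mulfI (lt0r_neq0 t0));
    rewrite e2 mulrA mulrCA mulfV ?gt_eqF// mulr1.
rewrite /raygap /= h1 h2 le_eqVlt; apply/orP; left; apply/eqP.
by field; apply/and3P; split; lra.
Qed.

(* Chains over finer and finer sets of rational times converge, along a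
   subfamily, in the compact product of the sets [K q]. *)
Lemma ray_limit (K : rat -> set X) (t : rat) (y : X) (A1 : set X) :
  (forall q, compact (K q)) -> 0 < t -> t < 1 -> K 1 `<=` A1 ->
  (forall n, exists w : rat -> X, [/\ w t = y, K 1 (w 1),
     forall q : rat, 0 < q <= 1 -> (pickle q < n)%N -> K q (w q) &
     forall q r : rat, (pickle q < n)%N -> (pickle r < n)%N -> 0 < q -> q < r
       -> r <= 1 ->
       ray q r (w q) (w r)]) ->
  intermediate x A1 (ratr t) y.
Proof.
move=> cK t0 t1 KA hw.
(* [x] is the placeholder at times not constrained at stage [n]; adding it to [K q] keeps each
   coordinate in a fixed compact set. *)
pose K' q : set X := K q `|` [set x].
have cK' q : compact (K' q) by apply: compactU => //; exact: compact_set1.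
have cP := tychonoff cK'.
have hw' n : exists w : rat -> X, [/\ forall q, K' q (w q), ((pickle t < n)%N
  -> w t = y),
     (pickle (1%R : rat) < n)%N -> K 1 (w 1) &
     forall q r : rat, (pickle q < n)%N -> (pickle r < n)%N -> 0 < q -> q < r
       -> r <= 1 ->
       ray q r (w q) (w r)].
  have [w [wt w1 wK wr]] := hw n.
  exists (fun q : rat => if (0 < q <= 1) && (pickle q < n)%N then w q else x);
    split.
  - by move=> q; case: ifPn => [/andP[? ?]|_]; [left; exact: wK|right].
  - by move=> ->; rewrite t0 ltW.
  - by move=> ->; rewrite ltr01 lexx.
  - move=> q r qn rn q0 qr r1.
    by rewrite qn rn q0 r1 (lt_trans q0 qr) (le_trans (ltW qr) r1)/=; exact: wr.
have [w_ wP] := choice hw'.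
have [w _ wlim] := compact_seq_limit cP (fun n => let: And4 a _ _ _ := wP n in
  a).
have cproj (q : rat) : continuous (fun w : prod_topology (fun _ : rat => X) =>
  w q).
  exact: (@proj_continuous rat (fun=> X) q).
have near_pickle (q : rat) : \forall n \near \oo, (pickle q < n)%N by exists
  (pickle q).+1.
have wt : w t = y.
  have cx : closed [set w : prod_topology (fun _ : rat => X) | w t = y].
    have c1 := compact_closed_metric (@compact_set1 _ y).
    by move: (cproj t) => /continuous_closedP/(_ _ c1).
  apply: (wlim _ cx); near=> n; have [_ + _ _] := wP n; apply; near: n;
    exact: near_pickle.
have w1 : K 1 (w 1).
  have cx : closed [set w : prod_topology (fun _ : rat => X) | K 1 (w 1)].
    by move: (cproj 1) => /continuous_closedP/(_ _ (compact_closed_metric (cK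
      1))).
  apply: (wlim _ cx); near=> n; have [_ _ + _] := wP n; apply; near: n;
    exact: near_pickle.
have wray (q r : rat) : 0 < q -> q < r -> r <= 1 -> ray q r (w q) (w r).
  move=> q0 qr r1; apply/raygapP; rewrite ?ltr0q ?ltr_rat//.
  have cqr : continuous (fun w : prod_topology (fun _ : rat => X) => (w q, w
    r)).
    by move=> v; exact: (cvg_pair (cproj q v) (cproj r v)).
  have cx : closed [set w : prod_topology (fun _ : rat => X) |
      raygap x (ratr q) (ratr r) (w q, w r) <= 0].
    have c1 : closed [set p | raygap x (ratr q) (ratr r) p <= 0].
      by move: (@raygap_continuous _ _ x (ratr q) (ratr r)) =>
        /continuous_closedP/(_ _ (@closed_le _ 0)).
    by move: cqr => /continuous_closedP/(_ _ c1).
  apply: (wlim _ cx); near=> n; rewrite /=; apply/raygapP;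
    rewrite ?ltr0q ?ltr_rat//.
  have [_ _ _ +] := wP n; apply => //; near: n; exact: near_pickle.
pose v := mdist x (w 1).
have xw (q : rat) : 0 < q -> q <= 1 -> mdist x (w q) = ratr q * v.
  move=> q0; rewrite le_eqVlt => /orP[/eqP->|q1];
    first by rewrite rmorph1 mul1r.
  by have [+ _] := wray _ _ q0 q1 (lexx _); rewrite rmorph1 mul1r.
have ww (q r : rat) : 0 < q -> q < r -> r <= 1 -> mdist (w q) (w r) = (ratr r -
  ratr q) * v.
  move=> q0 qr r1; have [_] := wray _ _ q0 qr r1.
  have r0 := lt_trans q0 qr; rewrite xw// mulrCA => /mulfI; apply.
  by rewrite gt_eqF// ltr0q.
(* Rays only concern positive times; at time 0 the curve is made to start at [x]. *)
pose W q := if q == 0 then x else w q.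
have WW (q r : rat) : 0 <= q -> q <= r -> r <= 1 -> mdist (W q) (W r) = (ratr r
  - ratr q) * v.
  rewrite le_eqVlt => /orP[/eqP<-|q0].
    rewrite /W eqxx rmorph0 subr0 le_eqVlt => /orP[/eqP<-|r0].
      by rewrite eqxx mdistxx rmorph0 mul0r.
    by rewrite gt_eqF// => r1; exact: xw.
  rewrite le_eqVlt => /orP[/eqP<-|qr r1]; first by rewrite mdistxx subrr mul0r.
  by rewrite /W !gt_eqF// ?(lt_trans q0 qr)// ww.
have W01 (q : rat) : 0 <= (ratr q : R) <= 1 -> 0 <= q /\ q <= 1.
  by rewrite ler0q -(rmorph1 (@ratr R)) ler_rat => /andP.
have [g geo gW] : exists2 g : R -> X, geodesic g &
    forall q : rat, 0 <= (ratr q : R) <= 1 -> g (ratr q) = W q.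
  apply: (@rat_geodesic_extension _ _ W v); first exact: mdist_ge0.
  move=> q r /W01[q0 q1] /W01[r0 r1].
  have [qr|rq] := leP q r.
    by rewrite WW// distrC ger0_norm// subr_ge0 ler_rat.
  by rewrite metric_sym WW// ?ltW// ger0_norm// subr_ge0 ler_rat ltW.
exists g; last by rewrite gW ?ler0q -?(rmorph1 (@ratr R)) ?ler_rat ?ltW// /W
  gt_eqF.
split => //.
- by rewrite -(rmorph0 (@ratr R)) gW ?rmorph0 ?lexx ?ler01// /W eqxx.
- by rewrite -(rmorph1 (@ratr R)) gW ?rmorph1 ?lexx ?ler01// /W oner_eq0;
    exact: KA.
Unshelve. all: by end_near. Qed.

(** Chains at level [n] exist through every point of a compact set [S n] of nearly full mass. A
    point in infinitely many [S n] has arbitrarily fine chains, as [ray_limit] requires, and the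
    upper limit of the [S n] nearly keeps their mass. *)
Lemma intermediate_mass (t : rat) (A1 : set X) (e : R) : 0 < t -> t < 1 ->
  measurable (A1 : set (borel X)) -> mu 1 A1 = 1%E -> 0 < e ->
  exists E : set X, [/\ measurable (E : set (borel X)),
    E `<=` intermediate x A1 (ratr t) & (mu (ratr t) (~` E) <= e%:E)%E].
Proof.
move=> t0 t1 mA1 A1full e0.
(* One third each for the upward chains, the downward chains and the passage to the upper limit. *)
pose d : R := e / 3; have d0 : 0 < d by rewrite divr_gt0.
have dq0 (q : rat) : 0 < d / (2 ^ (pickle q).+1)%:R by rewrite divr_gt0.
have /choice[K KP] q : exists K : set X, [/\ compact K, q = 1 -> K `<=` A1 &
    (mu (ratr q) (~` K) <= (d / (2 ^ (pickle q).+1)%:R)%:E)%E].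
  have [->|q1] := eqVneq q 1; last first.
    have [K [cK hK]] := ulam_tight (mu (ratr q)) sX (dq0 q).
    by exists K; split => // /eqP; rewrite (negPf q1).
  have [K [cK KA hK]] := borel_inner_compact (mu 1) sX mA1 (dq0 1).
  exists K; split => //; rewrite rmorph1.
  have mK := compact_borel cK.
  have mD : measurable (A1 `\` K : set (borel X)) by exact: measurableD.
  have mC := measurableC mA1.
  apply: (@le_trans _ _ (mu 1 ((A1 `\` K) `|` ~` A1))).
    apply: le_measure; rewrite ?inE; [exact: measurableC|exact: measurableU|].
    by move=> y Ky; have [Ay|Ay] := pselect (A1 y); [left|right].
  apply: le_trans (measureU2 _ mD mC) _.
  by rewrite [X in (_ + X)%E](probability_setC (mu 1) mA1) A1full subee// adde0.
have cK q : compact (K q) by have [] := KP q.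
(* The time 1 belongs to every level, so that each chain ends in [K 1], hence in [A1]. *)
pose lev n := undup (1 :: pmap (@unpickle rat) (iota 0 n)).
pose lu n := sort <=%R [seq q <- lev n | t < q <= 1].
pose ld n := rev (sort <=%R [seq q <- lev n | 0 < q < t]).
have plu n : path <%R t (lu n).
  rewrite (path_sortedE (@lt_trans _ rat)) sort_lt_sorted filter_uniq
    ?undup_uniq// andbT.
  by apply/allP => q; rewrite mem_sort mem_filter => /andP[/andP[]].
have pld n : path >%R t (ld n).
  rewrite (path_sortedE (rev_trans (@lt_trans _ rat))) /ld rev_sorted
    sort_lt_sorted.
  rewrite filter_uniq ?undup_uniq// andbT.
  by apply/allP => q; rewrite mem_rev mem_sort mem_filter => /andP[/andP[]].
have lu1 n : all (<= 1) (lu n).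
  by apply/allP => q; rewrite mem_sort mem_filter => /andP[/andP[]].
have ld0 n : all (> 0) (ld n).
  by apply/allP => q; rewrite mem_rev mem_sort mem_filter => /andP[/andP[]].
pose up n := chain_up x K t (lu n); pose down n := chain_down x K t (ld n).
have sumd l : uniq l -> (\sum_(q <- l) mu (ratr q) (~` K q) <= d%:E)%E.
  move=> ul; apply: le_trans (sum_pickle_le (ltW d0) ul).
  by apply: lee_sum => q _; have [] := KP q.
have upP n : compact (up n) /\ (mu (ratr t) (~` up n) <= d%:E)%E.
  have [cu hu] := chain_upP sX mu_geo mu0 mu1 cK t0 (plu n) (lu1 n).
  split => //; apply: le_trans hu (sumd _ _).
  exact: (@sorted_uniq _ <%R (@lt_trans _ rat) (@ltxx _ rat) (t :: lu n) (plu
    n)).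
have downP n : compact (down n) /\ (mu (ratr t) (~` down n) <= d%:E)%E.
  have [cu hu] := chain_downP sX mu_geo mu0 mu1 cK (ltW t1) (pld n) (ld0 n).
  split => //; apply: le_trans hu (sumd _ _).
  exact: (@sorted_uniq _ >%R (rev_trans (@lt_trans _ rat)) (@ltxx _ rat) (t ::
    ld n) (pld n)).
pose S n : set (borel X) := up n `&` down n.
have mS n : measurable (S n).
  by apply: measurableI; apply: compact_borel; [case: (upP n)|case: (downP n)].
have hS n : (mu (ratr t) (~` S n) <= (d + d)%:E)%E.
  rewrite setCI EFinD; apply: le_trans (leeD (upP n).2 (downP n).2).
  by apply: measureU2; apply: measurableC; apply: compact_borel;
    [case: (upP n)|case: (downP n)].
pose V n : set (borel X) := \bigcup_(j in [set j | (n <= j)%N]) S j.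
have mV n : measurable (V n) by exact: bigcup_measurable.
exists (lim_sup_set S); split.
- by apply: bigcapT_measurable => n; exact: mV.
- move=> y yS; apply: (ray_limit cK t0 t1) => [|n];
    first by have [_ + _] := KP 1; apply.
  have [j /= nj Sj] := yS n I.
  have [w [wt wK wr]] := chain_ray t0 (plu j) (pld j) (ld0 j) Sj.
  have levj q : (pickle q < n)%N -> q \in lev j.
    move=> qn; rewrite /lev mem_undup in_cons; apply/orP; right.
    rewrite mem_pmap; apply/mapP; exists (pickle q); last by rewrite pickleK.
    by rewrite mem_iota /= add0n (leq_trans qn).
  have mem q : q \in lev j -> 0 < q -> q <= 1 -> q \in t :: lu j ++ ld j.
    move=> qj q0 q1; rewrite in_cons mem_cat mem_rev !mem_sort !mem_filter qj
      q0 q1 !andbT /=.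
    by case: ltgtP.
  exists w; split => //.
  + by apply: wK; apply: mem => //; rewrite /lev mem_undup mem_head.
  + by move=> q /andP[q0 q1] /levj qj; apply: wK; exact: mem.
  + move=> q r /levj qj /levj rj q0 qr r1; apply: wr => //; apply: mem => //.
      exact: le_trans (ltW qr) r1.
    exact: lt_trans q0 qr.
have mL : measurable (lim_sup_set S) by apply: bigcapT_measurable => n;
  exact: mV.
have [||||n nP] := @measure_exhaust _ (borel X) R (mu (ratr t)) (fun n => ~` V
  n)
  (~` lim_sup_set S) _ _ _ _ d d0.
- by move=> n; exact: measurableC.
- exact: measurableC.
- by move=> i j ij; apply: subsetC => y [k /= jk Sk]; exists k => //=;
    exact: leq_trans jk.
- by rewrite /lim_sup_set setC_bigcap.
have mVn := measurableC (mV n); have mD := measurableD (measurableC mL) mVn.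
apply: (@le_trans _ _ (mu (ratr t) (~` V n `|` (~` lim_sup_set S `\` ~` V n)))).
  apply: le_measure; rewrite ?inE;
    [exact: measurableC|exact: measurableU mVn mD|].
  by move=> y Ly; have [?|?] := pselect ((~` V n) y); [left|right].
apply: le_trans (measureU2 _ mVn mD) _.
rewrite (_ : e = d + d + d) ?EFinD; last by rewrite /d; lra.
apply: leeD => //; rewrite -EFinD; apply: le_trans (hS n).
apply: le_measure; rewrite ?inE//; first exact: measurableC.
by apply: subsetC => y Sy; exists n => //=.
Qed.

Lemma intermediate_full (t : rat) (A1 : set X) : 0 < t -> t < 1 ->
  measurable (A1 : set (borel X)) -> mu 1 A1 = 1%E ->
  exists B : set X, [/\ measurable (B : set (borel X)),
    B `<=` intermediate x A1 (ratr t) & mu (ratr t) B = 1%E].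
Proof.
move=> t0 t1 mA1 A1full.
have V0 n : 0 < n.+1%:R^-1 :> R by rewrite invr_gt0.
have /choice[E EP] n := intermediate_mass t0 t1 mA1 A1full (V0 n).
have mE n : measurable (E n : set (borel X)) by have [] := EP n.
have mB : measurable (\bigcup_n E n : set (borel X)) by exact:
  bigcup_measurable.
exists (\bigcup_n E n); split => //; first by move=> y [n _];
  have [_ + _] := EP n; apply.
have C0 : mu (ratr t) (~` \bigcup_n E n) = 0%E.
  apply/eqP; rewrite eq_le measure_ge0 andbT; apply/lee_addgt0Pr => d d0;
    rewrite add0e.
  have [n] := ltr_add_invr d0; rewrite add0r => nd.
  apply: (@le_trans _ _ n.+1%:R^-1%:E); last by rewrite lee_fin ltW.
  have [_ _] := EP n; apply: le_trans; apply: le_measure; rewrite ?inE;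
    try exact: measurableC.
  by apply: subsetC => y Ey; exists n.
have := probability_setC (mu (ratr t)) (measurableC mB).
by rewrite setCK C0 sube0.
Qed.

End intermediate_mass.

(** * Entropy *)

(** Convexity of [r ln r], in the form of [ln u <= u - 1] at [u = a / r]. *)
Lemma xlnx_tangent (R : realType) (a r : R) : 0 < a -> 0 <= r ->
  (ln a + 1) * r - a <= r * ln r.
Proof.
move=> a0; rewrite le_eqVlt => /orP[/eqP<-|r0]; first by rewrite mulr0 mul0r;
  lra.
have ar0 : 0 < a / r by rewrite divr_gt0.
have : ln (a / r) <= a / r - 1.
  by have := @le_ln1Dx R (a / r - 1); rewrite [1 + _]addrC subrK; apply; lra.
rewrite ln_div ?posrE// => h.
have := ler_wpM2l (ltW r0) h;
  rewrite !mulrBr mulr1 mulrCA divff ?gt_eqF// mulr1.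
lra.
Qed.

Section entropy.
Context {R : realType} {X : completeMetricType R}.
Variable m : {measure set (borel X) -> \bar R}.
Implicit Types (mu : probability (borel X) R) (rho : X -> R).
Local Open Scope ereal_scope.

Local Notation xlnx rho := (fun x => (rho x * ln (rho x))%:E).

Lemma density_integral mu rho : is_density mu m rho ->
  \int[m]_x (rho x)%:E = 1.
Proof.
by case=> _ _ h; have <- := h setT measurableT; exact: (probability_setT mu).
Qed.

Lemma density_integrable mu rho : is_density mu m rho ->
  m.-integrable setT (EFin \o rho).
Proof.
move=> drho; have [mrho rho0 _] := drho; apply/integrableP; split.
  exact/measurable_EFinP.
under eq_integral do rewrite /= ger0_norm//.
by rewrite (density_integral drho) ltry.
Qed.

Lemma density_unique mu rho1 rho2 : is_density mu m rho1 -> is_density mu m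
    rho2 ->
  ae_eq m setT (EFin \o rho1) (EFin \o rho2).
Proof.
move=> d1 d2; have [m1 _ h1] := d1; have [m2 _ h2] := d2.
apply: integral_ae_eq => //; first exact: density_integrable d1.
  exact/measurable_EFinP.
by move=> E _ mE; rewrite /= -h1// -h2.
Qed.

Lemma xlnx_measurable rho : measurable_fun setT (rho : borel X -> R) ->
  measurable_fun setT (xlnx rho : borel X -> \bar R).
Proof.
move=> mrho; apply/measurable_EFinP; apply: measurable_funM => //.
by apply: measurableT_comp => //; exact: measurable_ln.
Qed.

(** [Ent] is computed with a density picked by choice; this lets any other density of the same
    measure replace it. *)
Lemma xlnx_ae rho1 rho2 : measurable_fun setT (rho1 : borel X -> R) ->
  measurable_fun setT (rho2 : borel X -> R) ->
  ae_eq m setT (EFin \o rho1) (EFin \o rho2) ->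
  m.-integrable setT (xlnx rho1) ->
  m.-integrable setT (xlnx rho2) /\ \int[m]_x (rho1 x * ln (rho1 x))%:E =
    \int[m]_x (rho2 x * ln (rho2 x))%:E.
Proof.
move=> /xlnx_measurable m1 /xlnx_measurable m2 e12 i1.
have e : ae_eq m setT (xlnx rho1) (xlnx rho2).
  exact: (ae_eq_comp (fun z : \bar R => (fine z * ln (fine z))%:E) e12).
split; last exact: ae_eq_integral.
move/integrableP : i1 => [_ i1]; apply/integrableP; split => //.
rewrite (@ae_eq_integral _ _ _ m setT (abse \o xlnx rho1))//.
- exact: measurableT_comp.
- exact: measurableT_comp.
- by apply: ae_eq_abse; exact: ae_eq_sym.
Qed.

(* Integrate the tangent line of [r ln r] at [1 / m B]. *)
Lemma jensen_xlnx mu rho (B : set X) : is_density mu m rho ->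
  m.-integrable setT (xlnx rho) -> measurable (B : set (borel X)) -> mu B = 1 ->
  expeR (- \int[m]_x (rho x * ln (rho x))%:E) <= m B.
Proof.
move=> drho irho mB muB; have [mrho rho0 hrho] := drho.
have [|mBfin] := eqVneq (m B) +oo; first by move->; rewrite leey.
have mB_fin : m B \is a fin_num by rewrite ge0_fin_numE ?measure_ge0// ltey.
have mBgt0 : 0 < m B.
  rewrite measure_gt0; apply/eqP => mB0; have := hrho B mB; rewrite muB.
  rewrite null_set_integral//; first by move=> /eqP; rewrite onee_eq0.
  by apply: measurable_funTS; exact/measurable_EFinP.
pose b := fine (m B); have bE : m B = b%:E by rewrite fineK.
have b0 : (0 < b)%R by rewrite -lte_fin -bE.
(* The cut-off changes the density on an [m]-null set only, and the constant term of the tangent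
   line can then be integrated over [B] alone, where it contributes 1 even if [m] is infinite. *)
pose rhoB : X -> R := fun y => (rho y * \1_B y)%R.
have mrhoB : measurable_fun setT (rhoB : borel X -> R).
  by apply: measurable_funM => //; exact: measurable_indic.
have mBC : mu (~` B) = 0.
  by have := probability_setC mu mB; rewrite muB subee.
have drhoB : is_density mu m rhoB.
  split => // [y|A mA]; first by rewrite mulr_ge0.
  have mAB : measurable (A `&` B : set (borel X)) by exact: measurableI.
  have -> : mu A = mu (A `&` B).
    have mAC : measurable (A `\` B : set (borel X)) by exact: measurableD.
    apply: eq_trans (measureDI mu mA mB) _; rewrite -[RHS]add0e; congr (_ + _).
    by apply: (subset_measure0 mAC (measurableC mB)) => // y [].
  rewrite hrho// integral_mkcondr; apply: eq_integral => y _.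
  by rewrite /patch /rhoB indicE; case: ifPn => _; rewrite ?mulr1 ?mulr0.
have [iB ->] := xlnx_ae mrho mrhoB (density_unique drho drhoB) irho.
have iBone : m.-integrable setT (EFin \o \1_B).
  apply/integrableP; split; first exact/measurable_EFinP.
  under eq_integral do rewrite /= ger0_norm//.
  by rewrite integral_indic// setIT ltey.
have irhoB := density_integrable drhoB.
have [I IE] : exists I, \int[m]_x (rhoB x * ln (rhoB x))%:E = I%:E.
  by exists (fine (\int[m]_x (rhoB x * ln (rhoB x))%:E));
    rewrite fineK// integrable_fin_num.
rewrite IE bE lee_fin -[leRHS]lnK ?posrE// ler_expR lerNl.
have k : \int[m]_x ((ln b^-1 + 1)%:E * (rhoB x)%:E - b^-1%:E * (\1_B x)%:E) <=
  I%:E.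
  rewrite -IE; apply: le_integral => //.
    by apply: integrableB => //; apply: integrableZl.
  move=> y _; rewrite -!EFinM -EFinB lee_fin /rhoB indicE.
  case: (y \in B); last by rewrite !mulr0 mul0r subr0.
  by rewrite !mulr1; apply: xlnx_tangent; rewrite ?invr_gt0.
move: k; rewrite integralB//; [|exact: integrableZl|exact: integrableZl].
rewrite !integralZl// (density_integral drhoB) integral_indic// setIT bE mule1.
rewrite -EFinM mulVf ?gt_eqF// -EFinB lee_fin lnV ?posrE//; lra.
Qed.

Lemma Ent_le_measure mu (B : set X) : Ent mu m < +oo ->
  measurable (B : set (borel X)) -> mu B = 1 -> expeR (- Ent mu m) <= m B.
Proof.
rewrite /Ent; case: ifPn => [/asboolP[drho _ irho] _ mB muB|];
  last by rewrite ltxx.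
exact: jensen_xlnx drho irho mB muB.
Qed.

Lemma Ent_uniform mu (A : set X) : measurable (A : set (borel X)) ->
  0 < m A < +oo ->
  (forall E : set X, measurable (E : set (borel X)) ->
    mu E = m (E `&` A) * (fine (m A))^-1%:E) ->
  finite_second_moment mu -> Ent mu m = (- ln (fine (m A)))%:E.
Proof.
move=> mA /andP[A0 Afin] muE m2.
have AE : m A = (fine (m A))%:E by rewrite fineK// ge0_fin_numE// ltW.
set b := fine (m A) in AE muE *.
have b0 : (0 < b)%R by rewrite -lte_fin -AE.
pose rho0 : X -> R := fun y => (b^-1 * \1_A y)%R.
have mrho0 : measurable_fun setT (rho0 : borel X -> R).
  by apply: measurable_funM => //; exact: measurable_indic.
have d0 : is_density mu m rho0.
  split => // [y|E mE]; first by rewrite mulr_ge0// invr_ge0 ltW.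
  rewrite muE// /rho0; under [RHS]eq_integral do rewrite EFinM.
  rewrite ge0_integralZl_EFin//; last 2 first.
    by apply: measurable_funTS; apply/measurable_EFinP; exact: measurable_indic.
    by rewrite invr_ge0 ltW.
  by rewrite integral_indic// setIC muleC.
have h0E x : (rho0 x * ln (rho0 x))%:E = (- ln b * b^-1)%:E * (\1_A x)%:E.
  rewrite /rho0 -EFinM indicE; case: (x \in A); last by rewrite !mulr0 mul0r.
  by rewrite !mulr1 lnV ?posrE// mulrC.
have iA : m.-integrable setT (EFin \o \1_A).
  apply/integrableP; split; first exact/measurable_EFinP.
  under eq_integral do rewrite /= ger0_norm//.
  by rewrite integral_indic// setIT.
have i0 : m.-integrable setT (xlnx rho0).
  by under eq_fun do rewrite h0E; exact: integrableZl.
have dd : is_density mu m (density mu m) by rewrite /density; apply: xgetPex;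
  exists rho0.
have [i1 e1] := xlnx_ae mrho0 (let: And3 a _ _ := dd in a) (density_unique d0
  dd) i0.
rewrite /Ent; case: ifPn => [_|/asboolPn[]//].
rewrite -e1; under eq_integral do rewrite h0E.
by rewrite integralZl// integral_indic// setIT AE -EFinM mulfVK ?gt_eqF.
Qed.

End entropy.

(** * Distortion coefficients *)

Section distortion_bounds.
Context {R : realType}.
Variables (s : R -> R) (c N : R).
Hypotheses (c0 : 0 < c) (N1 : 1 <= N)
  (scont : {within `[0, +oo[, continuous s})
  (sasymp : forall x, s x = c * x `^ N +o_(x \near 0^'+) (x `^ N)).

Let D := first_zero s.

Lemma asymp_near0 : exists2 d : R, 0 < d &
  forall x, 0 < x -> x < d -> c / 2 * x `^ N <= s x /\ s x <= 2 * c * x `^ N.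
Proof.
have [rem sE remP] : exists2 rem : R -> R, forall x, s x = c * x `^ N + rem x &
    forall e, 0 < e -> \forall x \near 0^'+, `|rem x| <= e * `|x `^ N|.
  by eexists; [exact: sasymp|apply: littleoP].
have [d /= d0 dP] : \forall x \near 0^'+,
    `|s x - c * x `^ N| <= c / 2 * `|x `^ N|.
  under eq_near do rewrite sE addrC addKr.
  by apply: remP; rewrite divr_gt0.
exists d => // x x0 xd.
have := dP x; rewrite /= sub0r normrN gtr0_norm// => /(_ xd x0).
rewrite (ger0_norm (powR_ge0 _ _)) ler_norml => /andP[h1 h2].
have p0 : 0 < x `^ N by rewrite powR_gt0.
have cp : 0 < c * x `^ N by rewrite mulr_gt0.
split; nra.
Qed.

Lemma first_zero_gt0 : (0 < D)%E.
Proof.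
have [d d0 dP] := asymp_near0; apply: (@lt_le_trans _ _ d%:E);
  first by rewrite lte_fin.
apply: le_ereal_inf_tmp => _ [x [x0 sx] <-]; rewrite lee_fin leNgt;
  apply/negP => xd.
have [+ _] := dP x x0 xd; rewrite sx leNgt => /negP; apply.
by rewrite mulr_gt0 ?divr_gt0 ?powR_gt0.
Qed.

Let scont_sub a b : 0 <= a -> {within `[a, b], continuous s}.
Proof.
move=> a0; apply: continuous_subspaceW scont => x /=; rewrite !in_itv/= andbT.
by move=> /andP[ax _]; exact: le_trans ax.
Qed.

(** [s] is positive near 0 by its asymptotics, so a nonpositive value at [x] would force a zero
    before [D] by the intermediate value theorem. *)
Lemma gt0_before_first_zero x : 0 < x -> (x%:E < D)%E -> 0 < s x.
Proof.
move=> x0 xD; rewrite ltNge; apply/negP => sx0.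
have [d d0 dP] := asymp_near0.
pose a := Num.min d x / 2.
have m0 : 0 < Num.min d x by rewrite lt_min d0 x0.
have a0 : 0 < a by rewrite divr_gt0.
have am : a < Num.min d x by rewrite /a; lra.
move: (am); rewrite lt_min => /andP[ad ax].
have sa : 0 < s a.
  have [+ _] := dP a a0 ad; apply: lt_le_trans.
  by rewrite mulr_gt0 ?divr_gt0 ?powR_gt0.
have [||z] := @IVT R s a x 0 (ltW ax); first exact: scont_sub (ltW a0).
  by rewrite ge_min sx0 orbT le_max (ltW sa).
rewrite in_itv/= => /andP[az zx] sz.
move: xD; rewrite ltNge => /negP; apply; apply: (@le_trans _ _ z%:E);
  last by rewrite lee_fin.
apply: ereal_inf_lbound.
by exists z => //; split => //; exact: lt_le_trans a0 az.
Qed.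

(** Near 0 the asymptotics apply; from [d / 2] on, the maximum of [s] is compared with the smallest
    power, at [d / 2]. The clause [2 * c <= C] keeps [C] positive and [c / 2 / C] below 1. *)
Lemma le_powR_on_segment M : exists2 C : R, 2 * c <= C &
  forall x, 0 < x -> x <= M -> s x <= C * x `^ N.
Proof.
have [d d0 dP] := asymp_near0.
have d20 : 0 < d / 2 by rewrite divr_gt0.
have dM : d / 2 <= Num.max M d by rewrite le_max; apply/orP; right; lra.
have [z zM smax] := EVT_max dM (scont_sub (ltW d20)).
have p0 : 0 < (d / 2) `^ N by rewrite powR_gt0.
exists (2 * c + `|s z| / (d / 2) `^ N); first by rewrite lerDl divr_ge0// ltW.
move=> x x0 xM; have px : 0 < x `^ N by rewrite powR_gt0.
rewrite mulrDl; have [xd|dx] := ltP x (d / 2).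
  have [_ h] := dP x x0 ltac:(lra).
  by rewrite (le_trans h)// lerDl mulr_ge0 ?divr_ge0// ltW.
apply: (@le_trans _ _ (`|s z| / (d / 2) `^ N * x `^ N)); last first.
  by rewrite lerDr !mulr_ge0// ltW.
apply: (@le_trans _ _ `|s z|).
  by apply: le_trans (ler_norm _); apply: smax; rewrite in_itv/= dx le_max xM.
rewrite -mulrA ler_peMr// mulrC ler_pdivlMr// mul1r.
by apply: ge0_ler_powR => //; rewrite ?nnegrE ?(ltW d20) ?(ltW x0)//;
  exact: le_trans N1.
Qed.

(** Below the first zero, [s (t th)] is at least [c / 2 * (t th)^N] and [s th] at most [C * th^N];
    the powers of [th] cancel, whence the uniformity in [th]. *)
Lemma distortion_ge M : 0 < M -> exists k t0 : R, [/\ 0 < k, 0 < t0, t0 <= 1 &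
  forall t th, 0 < t -> t <= t0 -> (0 <= th)%E -> (th <= M%:E)%E ->
    ((k * t `^ N)%:E <= distortion s N t th)%E].
Proof.
move=> M0; have [d d0 dP] := asymp_near0;
  have [C cC sC] := le_powR_on_segment M.
have cpos := c0; have C0 : 0 < C by lra.
(* The second bound keeps [t * x] at most [d / 2] for [x <= M], inside the range of the
   asymptotics. *)
exists (c / 2 / C), (Num.min 1 (d / 2 / M)); split.
- by rewrite !divr_gt0.
- by rewrite lt_min ltr01 !divr_gt0.
- by rewrite ge_min lexx.
move=> t th t0; rewrite le_min => /andP[t1 td] th0 thM.
have pt : 0 < t `^ N by rewrite powR_gt0.
have k1 : c / 2 / C <= 1 by rewrite ler_pdivrMr// mul1r; lra.
have ratio x : 0 < x -> x <= M -> (x%:E < D)%E -> c / 2 / C * t `^ N <= s (t *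
  x) / s x.
  move=> x0 xM xD; have px : 0 < x `^ N by rewrite powR_gt0.
  have sx := gt0_before_first_zero x0 xD.
  rewrite ler_pdivlMr//.
  have txd : t * x < d.
    have : t * x <= d / 2 / M * M by apply: ler_pM => //; exact: ltW.
    by rewrite divfK ?gt_eqF//; lra.
  have [h _] := dP (t * x) (mulr_gt0 t0 x0) txd.
  apply: le_trans h; rewrite (powRM N (ltW t0) (ltW x0)).
  have -> : c / 2 * (t `^ N * x `^ N) = c / 2 / C * t `^ N * (C * x `^ N).
    by field; rewrite gt_eqF.
  by rewrite ler_wpM2l ?sC// mulr_ge0 ?(ltW pt)// !divr_ge0// ltW.
rewrite /distortion -/D; case: ifPn => [_|thn0].
  by rewrite lee_fin ler_piMl// ltW.
have thgt0 : (0 < th)%E by rewrite lt0e thn0.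
case: ifPn => [thD|].
  move: th thM {th0 thn0} thgt0 thD => [x| |]//;
    rewrite lee_fin lte_fin => xM x0 xD.
  by rewrite lee_fin; exact: ratio.
rewrite -leNgt => Dth; rewrite limf_einfE.
(* Here [D <= th <= M], so the bound on ratios holds on the whole interval from 0 to [D] and passes
   to the lower limit at [D]. *)
apply: (@le_trans _ _ (ereal_inf [set (s (t * fine phi) / s (fine phi))%:E |
    phi in [set phi : \bar R | (0 < phi)%E /\ (phi < D)%E]])).
  apply: le_ereal_inf_tmp => _ [[x| |] [x0 xD] <-] //; last first.
    by have := lt_le_trans xD (le_trans Dth thM).
  rewrite lee_fin; apply: ratio => //.
  rewrite -lee_fin; exact: ltW (lt_le_trans xD (le_trans Dth thM)).
apply: ereal_sup_ubound;
  exists [set phi : \bar R | (0 < phi)%E /\ (phi < D)%E] => //.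
have : nbhs D [set phi : \bar R | (0 < phi)%E].
  by apply: open_nbhs_nbhs; split;
    [exact: open_ereal_gt_ereal|exact: first_zero_gt0].
by apply: filterS => phi phi0 phiD.
Qed.

End distortion_bounds.

(** * Integral bounds and uniform measures *)

Section integral_bounds.
Import HBNNSimple.
Local Open Scope ereal_scope.
Context d (T : measurableType d) (R : realType) (P : probability T R).

(** With no measurability of [f] at hand, the bound is checked on each simple function below [f]. *)
Lemma ge0_integral_le_cst (f : T -> \bar R) (A : set T) (c : R) :
  measurable A -> P (~` A) = 0 -> (0 <= c)%R -> (forall x, 0 <= f x) ->
  (forall x, A x -> f x <= c%:E) -> \int[P]_x f x <= c%:E.
Proof.
move=> mA PA c0 f0 fc; rewrite ge0_integralTE//;
  apply: ge_ereal_sup => _ [h hf <-].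
have mh : measurable_fun setT (EFin \o h) by apply/measurable_EFinP.
rewrite -integralT_nnsfun.
rewrite (@ge0_negligible_integral _ _ R P setT (~` A) (EFin \o h) (measurableC
  mA))//; last first.
  by move=> x _; rewrite lee_fin.
rewrite setTD setCK; apply: (@le_trans _ _ (\int[P]_(x in A) (cst c%:E) x)).
  apply: ge0_le_integral => //.
  - by move=> x _; rewrite lee_fin.
  - exact: measurable_funTS.
  - by move=> x Ax; exact: le_trans (hf x) (fc x Ax).
rewrite integral_cst//; apply: (@le_trans _ _ (c%:E * 1));
  last by rewrite mule1.
by apply: lee_wpmul2l; [rewrite lee_fin|exact: probability_le1].
Qed.

(* Here [f] may fail to be measurable: the integral of its negative part is
  still
   a supremum over the simple functions below it. *)
Lemma integral_ge_cst (f : T -> \bar R) (A : set T) (c : R) :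
  measurable A -> P (~` A) = 0 -> (c <= 0)%R ->
  (forall x, A x -> c%:E <= f x) -> c%:E <= \int[P]_x f x.
Proof.
move=> mA PA c0 cf; rewrite integralE -[leLHS]add0e; apply: leeD.
  by apply: integral_ge0 => x _; exact: funepos_ge0.
rewrite -[leLHS]oppeK leeN2 -EFinN.
apply: (@ge0_integral_le_cst _ A) => //; first by rewrite oppr_ge0.
move=> x Ax; rewrite funenegE ge_max lee_fin oppr_ge0 c0 andbT.
by rewrite EFinN leeN2 cf.
Qed.

End integral_bounds.

Lemma mnormalizeE d (T : measurableType d) (R : realType)
    (mu : {measure set T -> \bar R}) (P : probability T R) (U : set T) :
  (0 < mu setT < +oo)%E -> mnormalize mu P U = (mu U * (fine (mu
    setT))^-1%:E)%E.
Proof.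
by move=> /andP[mu0 mufin]; rewrite /mnormalize gt_eqF// lt_eqF.
Qed.

Section uniform_measure.
Context {R : realType} {X : completeMetricType R}.
Variables (m : {measure set (borel X) -> \bar R}) (A : set X) (x : X).
Hypotheses (mA : measurable (A : set (borel X))) (A0 : (0 < m A < +oo)%E).
Local Open Scope ereal_scope.

(** The Dirac mass is the fallback of [mnormalize] for total mass 0 or infinity, excluded once
    [0 < m A < +oo]. *)
Definition uniform_on : probability (borel X) R :=
  mnormalize (mrestr m mA) (\d_(x : borel X)).

Lemma uniform_onE (E : set X) : uniform_on E = m (E `&` A) * (fine (m A))^-1%:E.
Proof.
have mT : mrestr m mA setT = m A by rewrite /mrestr; congr (m _);
  exact: (@setTI X).
have A0T : 0 < mrestr m mA setT < +oo by rewrite mT.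
apply: eq_trans (mnormalizeE (\d_(x : borel X)) E A0T) _.
by congr (_ * (fine _)^-1%:E); exact: mT.
Qed.

Lemma uniform_on_full : uniform_on A = 1.
Proof.
move: A0 => /andP[A0' Afin].
have AE : m A = (fine (m A))%:E by rewrite fineK// ge0_fin_numE// ltW.
have A0'' : (0 < fine (m A))%R by rewrite -lte_fin -AE.
by rewrite uniform_onE setIid AE -EFinM /= mulfV ?gt_eqF.
Qed.

Lemma uniform_onC : uniform_on (~` A) = 0.
Proof. by rewrite uniform_onE setICl measure0 mul0e. Qed.

Lemma supp_uniform_on : supp uniform_on `<=` supp m.
Proof.
move=> y sy U oU Uy; have := sy U oU Uy; rewrite [X in 0 < X](uniform_onE U).
have mU := open_borel oU.
rewrite measure_gt0 => pos; apply/eqP => U0; move: pos.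
rewrite (_ : m (U `&` A) = 0) ?mul0e ?ltxx//.
by apply: (subset_measure0 (measurableI _ _ mU mA) mU) => // z [].
Qed.

Lemma supp_uniform_on_disjoint (U : set X) : open U -> U `&` A = set0 ->
  forall y, U y -> ~ supp uniform_on y.
Proof.
move=> oU UA y Uy sy; have := sy U oU Uy.
by rewrite [X in 0 < X](uniform_onE U) UA measure0 mul0e ltxx.
Qed.

End uniform_measure.

(** * Upper bound on the geodesic dimension *)

Section annulus.
Context {R : realType} {X : completeMetricType R}.
Implicit Types (x : X) (A : set X).

Lemma mbounded_mball x A (M : R) : (forall z, A z -> mdist x z <= M) ->
    mbounded A.
Proof.
move=> AM; apply: (@le_lt_trans _ _ (Num.max 0 (2 * M))%:E);
  last by rewrite ltry.
apply: ge_ereal_sup => _ [->|[[y z] [/= Ay Az] <-]]; rewrite lee_fin le_max.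
  by rewrite lexx.
apply/orP; right; have := metric_triangle y x z.
by rewrite (metric_sym y x); have := AM _ Ay; have := AM _ Az; lra.
Qed.

Lemma pair_borel_measurable x :
  measurable_fun setT ((fun z => (x, z)) : borel X -> borel (X * X)%type).
Proof.
apply: (@measurability _ _ (borel X) (borel (X * X)%type) setT _ (@open (X *
  X)%type) (erefl _)) => // _ [U oU <-].
have -> : [set: borel X] `&` (fun z : X => (x, z)) @^-1` U = (fun z : X => (x,
  z)) @^-1` U.
  exact: (@setTI X).
apply: open_borel; apply: open_comp => // z _.
by apply: cvg_pair; [exact: cvg_cst|exact: cvg_id].
Qed.

(** The truncated annuli [F n] exhaust the set of the non-triviality condition, so countable
    subadditivity gives one of positive mass; boundedness makes this mass finite. *)
Lemma gauge_annulus (m : {measure set (borel X) -> \bar R}) (G : X * X -> \bar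
    R) x :
  finite_on_bounded m -> gauge G ->
  (0 < m [set z : X | z <> x /\ (G (x, z) < +oo)%E])%E ->
  exists (A : set X) (M : R), [/\ 0 < M, measurable (A : set (borel X)),
    (0 < m A < +oo)%E, forall z, A z -> M^-1 <= mdist x z <= M &
    forall z, A z -> (G (x, z) <= M%:E)%E].
Proof.
move=> mfin [mG G0] mpos.
pose F n : set X := [set z | n.+1%:R^-1 <= mdist x z] `&`
  ([set z | mdist x z <= n.+1%:R] `&` [set z | (G (x, z) <= n.+1%:R%:E)%E]).
have mF n : measurable (F n : set (borel X)).
  apply: measurableI.
    apply: closed_borel.
    by move: (@mdistl_continuous _ _ x) => /continuous_closedP/(_ _ (@closed_ge
      _ n.+1%:R^-1)).
  apply: measurableI; first by apply: closed_borel; exact: closed_mball.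
  have mGx := measurableT_comp mG (pair_borel_measurable x).
  have := emeasurable_fun_infty_c measurableT mGx n.+1%:R%:E.
  by rewrite [X in measurable X](@setTI X).
have Ffin n : (m (F n) < +oo)%E.
  by apply: mfin => //; apply: (@mbounded_mball x _ n.+1%:R) => z [_ []].
have [n Fn] : exists n, (0 < m (F n))%E.
  apply: contrapT => noF; move: mpos; apply/negP; rewrite -leNgt.
  have F0 n : m (F n) = 0%E.
    by apply/eqP; rewrite -measure_le0 leNgt; apply/negP => Fn; apply: noF;
      exists n.
  have mUF : measurable (\bigcup_n F n : set (borel X)) by exact:
    bigcup_measurable.
  rewrite (_ : [set z | _] = \bigcup_n F n).
    have h := @measure_sigma_subadditive _ _ _ m (\bigcup_n F n) F mF mUF (fun
      _ y => y).
    by apply: le_trans h _; rewrite eseries0.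
  apply/seteqP; split => [z /= [zx Gz]|z [n _ [z1 [z2 z3]]]]; last first.
    split; last by apply: le_lt_trans z3 _; rewrite ltry.
    by move=> zx; move: z1; rewrite /= zx mdistxx leNgt invr_gt0 ltr0n.
  have d0 : 0 < mdist x z by rewrite mdist_gt0; apply/eqP => /esym.
  have [n1 hn1] := ltr_add_invr d0; rewrite add0r in hn1.
  have Gfin : G (x, z) \is a fin_num by rewrite ge0_fin_numE.
  pose n2 := Num.truncn (mdist x z); pose n3 := Num.truncn (fine (G (x, z))).
  exists (n1 + n2 + n3)%N => //; split=> /=.
    apply: ltW; apply: le_lt_trans hn1; rewrite lef_pV2 ?posrE// ler_nat ltnS.
    by rewrite -addnA leq_addr.
  split.
    apply: ltW; apply: lt_le_trans (truncnS_gt _) _; rewrite ler_nat ltnS.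
    by rewrite addnAC leq_addl.
  rewrite -(fineK Gfin) lee_fin.
  apply: ltW; apply: lt_le_trans (truncnS_gt _) _; rewrite ler_nat ltnS.
  by rewrite leq_addl.
exists (F n), n.+1%:R; split => //.
- by rewrite Fn Ffin.
- by move=> z [z1 [z2 _]]; apply/andP.
- by move=> z [_ []].
Qed.

End annulus.

Section geodesic_dimension.
Context {R : realType} {X : completeMetricType R}.
Variables (m : {measure set (borel X) -> \bar R}) (G : X * X -> \bar R)
  (N : R) (beta : R -> \bar R -> \bar R).
Hypotheses (sX : separable X) (mfin : finite_on_bounded m) (gG : gauge G)
  (N1 : 1 <= N) (hbeta : distortion_coefficient N beta) (hmcp : MCP m G beta).
Variable x : X.
Hypotheses (xm : supp m x)
  (nontriv : (0 < m [set z : X | z <> x /\ (G (x, z) < +oo)%E])%E).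

(** With [l = k t^N] and [Ent mu1 m = - ln (m A)], the condition bounds [exp (- Ent (mu t) m / n)]
    from below by the [n]-th root of [l * m A]; taking [n]-th powers removes [n]. *)
Lemma MCP_intermediate_ge : exists (A : set X) (k t0 : R),
  [/\ [/\ measurable (A : set (borel X)), mbounded A, ~ A x & (0 < m A <
    +oo)%E],
      0 < k, 0 < t0 &
  forall q : rat, 0 < q -> ratr q < t0 ->
    ((k * (ratr q) `^ N)%:E * m A <=
      @completed_measure_extension _ _ _ m (intermediate x A (ratr q)))%E].
Proof.
have [A [M [M0 mA mApos AM AG]]] := gauge_annulus mfin gG nontriv.
have [s [c [c0 scont sasymp betaE]]] := hbeta.
have [k [t0 [k0 t00 t01 kP]]] := distortion_ge c0 N1 scont sasymp M0.
have [n n1 mcp] := hmcp.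
have n0 : 0 < n := lt_le_trans ltr01 n1.
pose mu1 := uniform_on m x mA.
have mu1A : mu1 A = 1%E by exact: uniform_on_full.
have mu1C : mu1 (~` A) = 0%E by exact: uniform_onC.
have AE : m A = (fine (m A))%:E.
  by move: mApos => /andP[? ?]; rewrite fineK// ge0_fin_numE// ltW.
set b := fine (m A) in AE.
have b0 : 0 < b by move: mApos; rewrite AE lte_fin => /andP[].
have moment2 : (\int[mu1]_y ((mdist x y) ^+ 2)%:E <= (M ^+ 2)%:E)%E.
  apply: (@ge0_integral_le_cst _ _ _ mu1 _ A) => //.
  - exact: sqr_ge0.
  - by move=> y; rewrite lee_fin sqr_ge0.
  - move=> y /AM /andP[_ yM]; rewrite lee_fin lerXn2r// nnegrE ?mdist_ge0//.
    exact: ltW.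
have ent1 : Ent mu1 m = (- ln b)%:E.
  apply: (Ent_uniform mA mApos); first by move=> E mE; exact: uniform_onE.
  by exists x; apply: le_lt_trans moment2 _; rewrite ltry.
have suppM y : supp mu1 y -> mdist x y <= M.
  move=> sy; rewrite leNgt; apply/negP => My.
  apply: (@supp_uniform_on_disjoint _ _ m A x mA mApos [set z | M < mdist x z]
    _ _ y) => //.
  - by move: (@mdistl_continuous _ _ x) => /continuousP/(_ _ (@open_gt _ M)).
  - apply/seteqP; split => // z [/= zM /AM /andP[_]]; by rewrite leNgt zM.
have xsupp : ~ supp mu1 x.
  apply: (@supp_uniform_on_disjoint _ _ m A x mA mApos [set z | mdist x z <
    M^-1]).
  - exact: open_mball.
  - apply/seteqP; split => // z [/= zM /AM /andP[+ _]]; by rewrite leNgt zM.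
  - by rewrite /= mdistxx invr_gt0.
have pbs : Pbs m mu1.
  split; [exact: mbounded_mball suppM|exact: supp_uniform_on|by rewrite ent1
    ltry].
have [mu [mugeo mu0 mu1E mcpt]] := mcp x mu1 xm pbs xsupp.
exists A, k, t0; split => //.
  split => //; first by apply: (@mbounded_mball _ _ x _ M) => z /AM /andP[].
  by move=> /AM; rewrite mdistxx leNgt invr_gt0 M0.
move=> q q0 qt0; set t : R := ratr q.
have tpos : 0 < t by rewrite ltr0q.
have t1 : t < 1 by exact: lt_le_trans qt0 t01.
have q1 : q < 1 by rewrite -(@ltr_rat R) rmorph1.
have mu1fin : (\int[mu 1%R]_y ((mdist x y) ^+ 2)%:E < +oo)%E.
  rewrite (eq_measure_integral mu1)/=; last by move=> B mB _; exact: mu1E.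
  by apply: le_lt_trans moment2 _; rewrite ltry.
have mu1A' : mu 1 A = 1%E by apply: eq_trans (mu1E _ mA) _.
have [B [mB BA muB]] := intermediate_full sX mugeo mu0 mu1fin q0 q1 mA mu1A'.
pose l : R := k * t `^ N.
have l0 : 0 < l by rewrite mulr_gt0 ?powR_gt0.
have kt th : (0 <= th)%E -> (th <= M%:E)%E -> (l%:E <= beta t th)%E.
  move=> th0 thM; rewrite betaE//; last by rewrite in_itv/= !ltW.
  by apply: kP => //; exact: ltW.
(* The distortion at 0 equals [t^N]. The bound gives [ln l <= 0], the sign required by the one-sided
   integral estimate. *)
have l1 : l <= 1.
  have := kt 0%E (lexx _) ltac:(by rewrite lee_fin ltW).
  rewrite betaE//; last by rewrite in_itv/= !ltW.
  rewrite /distortion eqxx lee_fin => /le_trans; apply.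
  have := @ge0_ler_powR R N (le_trans ler01 N1) t 1; rewrite powR1; apply.
  - by rewrite nnegrE ltW.
  - by rewrite nnegrE.
  - exact: ltW.
have Iint : ((ln l)%:E <= \int[mu1]_y lne (beta t (G (x, y))))%E.
  apply: (@integral_ge_cst _ _ _ mu1 _ A) => //; first exact: ln_le0.
  move=> y Ay; rewrite -lne_EFin// lee_lne.
  - by apply: kt; [case: gG|exact: AG].
  - by rewrite in_itv/= lee_fin ltW// leey.
  - rewrite in_itv/= leey andbT; apply: le_trans (kt _ _ (AG _ Ay)).
      by rewrite lee_fin ltW.
    by case: gG.
have t01' : 0 < t < 1 by rewrite tpos t1.
have ineq := mcpt t t01'.
have LHS : (expeR (n^-1 * ln (l * b))%:E <= Un n (mu t) m)%E.
  apply: le_trans ineq; rewrite /Un ent1.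
  rewrite lnM ?posrE// mulrDr EFinD expeRD -EFinM -EFinN mulNr opprK (mulrC
    n^-1 (ln b)).
  rewrite EFinM; apply: lee_wpmul2r; first exact: (expeR_ge0 (ln b / n)%:E).
  rewrite -[leLHS]/(expeR (n^-1 * ln l)%:E) lee_expeR EFinM;
    apply: lee_wpmul2l => //.
  by rewrite lee_fin invr_ge0 ltW.
have entfin : (Ent (mu t) m < +oo)%E.
  rewrite ltey; apply/eqP => entoo; move: LHS; rewrite /Un entoo.
  rewrite gt0_mulye ?lte_fin ?invr_gt0//= leNgt => /negP; apply.
  by rewrite lte_fin expR_gt0.
have lb : ((l * b)%:E <= expeR (- Ent (mu t) m))%E.
  rewrite -[X in (X <= _)%E](@lneK R);
    last by rewrite in_itv/= leey andbT lee_fin mulr_ge0// ltW.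
  rewrite lee_expeR lne_EFin; last exact: mulr_gt0 l0 b0.
  move: LHS entfin; rewrite /Un lee_expeR; case: (Ent (mu t) m) => [e| |]// + _.
    rewrite -EFinM -!EFinN !lee_fin mulrC -mulNr ler_pM2r ?invr_gt0//.
  by rewrite leey.
apply: (@le_trans _ _ (l * b)%:E); first by rewrite [leRHS]EFinM -AE.
apply: le_trans lb _; apply: le_trans (Ent_le_measure entfin mB muB) _.
(* The extension agrees with [m] on Borel sets and is monotone on all sets, so the Borel subset [B]
   bounds the intermediate points from below. *)
rewrite -(measurable_mu_extE m mB); exact: le_mu_ext.
Qed.

Lemma Cgeo_infty (s : R) : N < s -> Cgeo m s x = +oo%E.
Proof.
move=> Ns; have [A [k [t0 [hA k0 t00 hq]]]] := MCP_intermediate_ge.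
have [_ _ _ /andP[mA0 mAfin]] := hA.
have AE : m A = (fine (m A))%:E by rewrite fineK// ge0_fin_numE// ltW.
set b := fine (m A) in AE.
have b0 : 0 < b by rewrite -lte_fin -AE.
apply/eqP; rewrite -leye_eq; apply: le_trans; last first.
  by apply: ereal_sup_ubound; right; exists A.
apply: le_ereal_inf_tmp => _ [V V0 <-].
rewrite leye_eq; apply/eqP/eqyP => L L0.
have [e /= e0 eV] := V0.
have sN : 0 < s - N by rewrite subr_gt0.
(* Below [r] one has [k t^(N - s) >= L], as [s > N]. *)
pose r : R := (k / L) `^ (s - N)^-1.
have r0 : 0 < r by rewrite powR_gt0// divr_gt0.
have /rat_in_itvoo[q] : 0 < Num.min e (Num.min t0 r) by rewrite !lt_min e0 t00
  r0.
rewrite in_itv/= !lt_min => /andP[q0 /andP[qe /andP[qt0 qr]]].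
apply: ereal_sup_ge; exists (((ratr q `^ s)^-1)%:E *
  (@completed_measure_extension _ _ _ m (intermediate x A (ratr q)) / m A))%E.
  by exists (ratr q) => //; apply: eV => //=; rewrite sub0r normrN gtr0_norm.
have {hq} := hq q; rewrite -(ltr0q R) => /(_ q0 qt0).
set t : R := ratr q in q0 qe qt0 qr *.
move=> h; have ts0 : 0 < t `^ s by rewrite powR_gt0.
apply: (@le_trans _ _ (((t `^ s)^-1)%:E * (k * t `^ N)%:E)%E).
  rewrite -EFinM lee_fin ler_pdivlMl//.
  have -> : t `^ s = t `^ (s - N) * t `^ N.
    by rewrite -powRD ?subrK// (gt_eqF q0) implybT.
  rewrite mulrAC ler_pM2r ?powR_gt0// -ler_pdivlMr//.
  have -> : k / L = r `^ (s - N).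
    by rewrite /r -powRrM mulVf ?gt_eqF// powRr1// divr_ge0// ltW.
  by apply: ge0_ler_powR; rewrite ?nnegrE ?ltW.
apply: lee_wpmul2l; first by rewrite lee_fin invr_ge0 ltW.
have -> : ((k * t `^ N)%:E = (k * t `^ N)%:E * m A / m A)%E.
  by rewrite AE inver gt_eqF// -!EFinM mulfK ?gt_eqF.
apply: lee_wpmul2r => //; rewrite AE inver gt_eqF// lee_fin invr_ge0 ltW//.
Qed.

Lemma dim_geo_le : (dim_geo m x <= N%:E)%E.
Proof.
apply/lee_addgt0Pr => e e0; apply: ereal_inf_lbound.
exists (N + e); last by rewrite EFinD.
split; last by apply: Cgeo_infty; rewrite ltrDl.
by rewrite addr_gt0// (lt_le_trans ltr01).
Qed.

End geodesic_dimension.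

(** * Hausdorff dimension *)

Section hausdorff.
Context {R : realType} {X : completeMetricType R}.
Implicit Types (S : set X) (s delta : R).

Lemma diam_ge0 (A : set X) : (0 <= diam A)%E.
Proof. by apply: ereal_sup_ubound; left. Qed.

Lemma diam0 : diam (set0 : set X) = 0%E.
Proof.
apply/eqP; rewrite eq_le diam_ge0 andbT.
by apply: ge_ereal_sup => _ [->//|[[y z] [[]]]].
Qed.

Lemma diam_mball_le (y : X) (r : R) : 0 <= r -> (diam [set z | mdist y z < r]%R
    <= (2 * r)%:E)%E.
Proof.
move=> r0; apply: ge_ereal_sup => _ [->|[[u v] [/= yu yv] <-]]; rewrite lee_fin.
  by rewrite mulr_ge0.
by have := metric_triangle u y v; rewrite (metric_sym u y); lra.
Qed.

Lemma hausdorff_pre_ge0 s delta S : (0 <= hausdorff_pre s delta S)%E.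
Proof.
apply: le_ereal_inf_tmp => _ [E _ <-].
by apply: nneseries_ge0 => n _ _; exact: poweR_ge0.
Qed.

Lemma hausdorff_pre_le_double s delta S (F : nat -> nat -> set X) :
  S `<=` \bigcup_n \bigcup_k F n k -> (forall n k, (diam (F n k) <=
    delta%:E)%E) ->
  (hausdorff_pre s delta S <=
    \sum_(n <oo) \sum_(k <oo) poweR (diam (F n k)) s)%E.
Proof.
move=> SF Fd; have /card_esym/ppcard_eqP[f] := card_nat2.
pose phi (p : nat * nat) := poweR (diam (F p.1 p.2)) s.
have phi0 p : (0 <= phi p)%E by exact: poweR_ge0.
apply: (@le_trans _ _ (\sum_(i <oo) phi (f i))%E).
  apply: ereal_inf_lbound; exists (fun i => F (f i).1 (f i).2) => //;
    split => //.
  move=> y /SF[n _ [k _ Fy]]; exists (f^-1%FUN (n, k)) => //=.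
  by rewrite invK ?inE.
rewrite nneseries_esumT; last by move=> n; exact: phi0.
have fbij : set_bij [set: nat] [set: nat * nat] f by split.
rewrite -(@reindex_esum _ _ _ setT setT f phi fbij).
rewrite [leRHS](_ : _ = (\esum_(n in setT) \esum_(k in setT) phi (n, k))%E).
  rewrite esum_esum// (_ : setT `*`` _ = setT); last by apply/seteqP; split.
  by apply: le_esum => -[n k] _.
rewrite nneseries_esumT; last first.
  by move=> n; apply: nneseries_ge0 => k _ _; exact: poweR_ge0.
by apply: eq_esum => n _; rewrite nneseries_esumT// => k; exact: poweR_ge0.
Qed.

Local Notation half := (2^-1 : R).

Let half_gt0 : 0 < half. Proof. by rewrite invr_gt0. Qed.

Lemma half_pow_powR n (b : R) : (half ^+ n) `^ b = (half `^ b) ^+ n.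
Proof. by rewrite -!powR_mulrn ?powR_ge0 ?(ltW half_gt0)// -!powRrM mulrC. Qed.

Lemma half_powR_lt1 (b : R) : 0 < b -> 0 < half `^ b < 1.
Proof.
move=> b0; rewrite powR_gt0//=; have := @gt0_ltr_powR R b b0 half 1.
rewrite powR1; apply; rewrite ?nnegrE ?ler01 ?(ltW half_gt0)//.
by rewrite invf_lt1// ltr1n.
Qed.

Lemma expr_small (a e : R) : 0 <= a < 1 -> 0 < e ->
  exists n0, forall n, (n0 <= n)%N -> a ^+ n <= e.
Proof.
move=> /andP[a0 a1] e0.
have : `|a| < 1 by rewrite ger0_norm.
move=> /cvg_expr/cvgrPdist_le/(_ _ e0)[n0 _ n0P]; exists n0 => n n0n.
have := n0P n n0n; rewrite /= sub0r normrN ger0_norm// exprn_ge0//.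
Qed.

Lemma nneseries_finite_le (a : nat -> \bar R) (K : nat) (w : R) : 0 <= w ->
  (forall k, (0 <= a k)%E) -> (forall k, (a k <= w%:E)%E) ->
  (forall k, (K <= k)%N -> a k = 0%E) ->
  (\sum_(k <oo) a k <= (K%:R * w)%:E)%E.
Proof.
move=> w0 a0 aw aK; apply: lime_le; first exact: is_cvg_nneseries.
near=> N; have KN : (K <= N)%N by near: N; exists K.
rewrite (big_cat_nat (leq0n K) KN)//= [X in (_ + X)%E]big1_seq ?adde0;
  last first.
  by move=> i /andP[_]; rewrite mem_index_iota => /andP[Ki _]; exact: aK.
apply: (@le_trans _ _ (\sum_(0 <= k < K) w%:E)%E); first exact: lee_sum.
by rewrite sumEFin lee_fin big_const_nat iter_addr_0 subn0 mulr_natl.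
Unshelve. all: by end_near. Qed.

Lemma geometric_tail_le (a : R) (n0 : nat) : 0 <= a < 1 ->
  (\sum_(n <oo) (if (n0 <= n)%N then a ^+ n else 0)%:E <= (a ^+ n0 / (1 -
    a))%:E)%E.
Proof.
move=> /andP[a0 a1]; have a1' : 0 < 1 - a by rewrite subr_gt0.
apply: lime_le.
  by apply: is_cvg_nneseries => n _ _; rewrite lee_fin; case: ifP => // _;
    exact: exprn_ge0.
near=> N; rewrite sumEFin lee_fin ler_pdivlMr//.
have h M : (\sum_(0 <= n < M) (if (n0 <= n)%N then a ^+ n else 0)) * (1 - a) =
    if (n0 <= M)%N then a ^+ n0 - a ^+ M else 0.
  elim: M => [|M IH].
    by rewrite big_nil mul0r leqn0; case: eqP => // ->; rewrite subrr.
  rewrite big_nat_recr//= mulrDl IH; have [nM|Mn] := leqP n0 M.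
    by rewrite (leqW nM) exprSr; ring.
  rewrite mul0r addr0; case: (leqP n0 M.+1) => // nM.
  by rewrite (_ : n0 = M.+1) ?subrr//; apply/eqP; rewrite eqn_leq nM Mn.
rewrite h; case: ifP => _; last exact: exprn_ge0.
by rewrite gerBl exprn_ge0.
Unshelve. all: by end_near. Qed.

End hausdorff.

(** * Lower density of the measure and packing by balls *)

Section density.
Context {R : realType} {X : completeMetricType R}.
Variable m : {measure set (borel X) -> \bar R}.
Hypothesis mfin : finite_on_bounded m.
Implicit Types (x y : X) (F : seq X).

Local Notation half := (2^-1 : R).
Local Notation B x r := [set y | (mdist x y < r)%R].

Lemma mball_measurable x (r : R) : measurable (B x r : set (borel X)).
Proof. by apply: open_borel; exact: open_mball. Qed.

Lemma mball_lty x (r : R) : (m (B x r) < +oo)%E.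
Proof.
apply: mfin; first exact: mball_measurable.
by apply: (@mbounded_mball _ _ x _ r) => z /ltW.
Qed.

(** Induction removes one ball from [U] at a time: the separation [2 * h] keeps the other balls
    inside what is left. *)
Lemma separated_balls_measure (h dl : R) F (U : set X) :
  pairwise (fun y z => 2 * h <= mdist y z) F ->
  (forall y, y \in F -> (dl%:E <= m (B y h))%E) ->
  (forall y, y \in F -> B y h `<=` U) -> measurable (U : set (borel X)) ->
  (((size F)%:R * dl)%:E <= m U)%E.
Proof.
elim: F U => [|y F IH] U /=; first by rewrite mul0r measure_ge0.
move=> /andP[/allP yF pF] FB FU mU.
have mB := mball_measurable y h.
have BU : B y h `<=` U by apply: FU; rewrite mem_head.
have h1 : (((size F)%:R * dl)%:E <= m (U `\` B y h))%E.
  apply: IH => //; last exact: measurableD.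
    by move=> z zF; apply: FB; rewrite in_cons zF orbT.
  move=> z zF u zu; split; first by apply: (FU z) => //;
    rewrite in_cons zF orbT.
  move=> /= yu; have := yF z zF; have := metric_triangle y u z.
  by move: zu => /=; rewrite (metric_sym z u) => ? ? ?; lra.
have h2 : (dl%:E <= m (U `&` B y h))%E.
  by rewrite setIidr//; apply: FB; rewrite mem_head.
apply: (@le_trans _ _ (m (U `\` B y h) + m (U `&` B y h))%E).
  apply: le_trans (leeD h1 h2); rewrite -EFinD lee_fin.
  by rewrite -natr1 mulrDl mul1r.
by rewrite le_eqVlt; apply/orP; left; apply/eqP/esym; exact: measureDI.
Qed.

(** The bound [K] on lengths yields a separated list of maximal length; a point far from all its
    members could be added to it. *)
Lemma maximal_separated (P : set X) (h : R) (K : nat) : 0 < h ->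
  (forall F, pairwise (fun y z => 2 * h <= mdist y z) F ->
    (forall y, y \in F -> P y) -> (size F <= K)%N) ->
  exists F, [/\ pairwise (fun y z => 2 * h <= mdist y z) F,
    (forall y, y \in F -> P y) &
    forall x, P x -> exists2 y, y \in F & mdist y x < 2 * h].
Proof.
move=> h0 PK; pose Q k := `[< exists F, [/\ pairwise (fun y z => 2 * h <= mdist
  y z) F,
  (forall y, y \in F -> P y) & size F = k] >].
have Q0 : exists k, Q k by exists 0%N; apply/asboolP; exists [::].
have QK k : Q k -> (k <= K)%N by move=> /asboolP[F [pF FP <-]]; exact: PK.
case: (ex_maxnP Q0 QK) => k /asboolP[F [pF FP Fk]] kmax.
exists F; split => // x Px; apply: contrapT => nx.
suff : (k.+1 <= k)%N by rewrite ltnn.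
apply: kmax; apply/asboolP; exists (x :: F); split => /=; last by rewrite Fk.
  rewrite pF andbT; apply/allP => y yF; rewrite leNgt; apply/negP => xy.
  by apply: nx; exists y => //; rewrite metric_sym.
by move=> y; rewrite in_cons => /orP[/eqP->//|]; exact: FP.
Qed.

Lemma half_exp_ex (u : R) : 0 < u -> u < 1 ->
  exists n, half ^+ n.+1 <= u /\ u < half ^+ n.
Proof.
move=> u0 u1.
have h01 : 0 <= half < 1 by rewrite invr_ge0 ler0n invf_lt1// ltr1n.
have [n0 n0P] := expr_small h01 u0.
have ex : exists n, half ^+ n <= u by exists n0; exact: n0P.
case: (ex_minnP ex) => -[|n] nu nmin; first by rewrite expr0 leNgt u1 in nu.
exists n; split => //; rewrite ltNge; apply/negP => /nmin; by rewrite ltnn.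
Qed.

Lemma intermediate_mball x (A : set X) (r t : R) : (forall z, A z -> mdist x z
    <= r) ->
  0 <= t -> t <= 1 -> intermediate x A t `<=` [set y | mdist x y <= t * r].
Proof.
move=> Ar t0 t1 _ [g [geo g0 Ag1] <-] /=.
have := geo 0 t; rewrite !in_itv/= lexx ler01 t0 t1 => /(_ isT isT).
by rewrite g0 => ->; rewrite sub0r normrN ger0_norm// ler_wpM2l// Ar.
Qed.

(** An infinite [Cgeo] at some [s0 < s] gives arbitrarily small [t] with intermediate points of mass
    above [t^s0 * m A]. They lie within [t * r] of [x], and [n] is the dyadic scale of [t * r]; the
    gap [s - s0] absorbs the constants. *)
Lemma dim_geo_density x (s : R) : (dim_geo m x < s%:E)%E ->
  forall n0, exists2 n, (n0 <= n)%N & (((half ^+ n) `^ s)%:E <= m (B x (half ^+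
    n)))%E.
Proof.
move=> /ereal_inf_lt[_ [s0 [s00 Coo] <-]]; rewrite lte_fin => s0s n0.
have : (1 < Cgeo m s0 x)%E by rewrite Coo ltry.
move=> /ereal_sup_gt[_ [->|[A [mA bA Ax /andP[mA0 mAfin]] <-]]].
  by rewrite lte_fin ltr10.
move=> lim1.
have AE : m A = (fine (m A))%:E by rewrite fineK// ge0_fin_numE// ltW.
set b := fine (m A) in AE.
have b0 : 0 < b by rewrite -lte_fin -AE.
have [r r0 Ar] : exists2 r : R, 0 < r & forall z, A z -> mdist x z <= r.
  have [a Aa] : A !=set0.
    by apply/set0P; apply/eqP => A0; move: mA0; rewrite A0 measure0 ltxx.
  have dfin : diam A \is a fin_num by rewrite ge0_fin_numE// diam_ge0.
  exists (mdist x a + fine (diam A) + 1).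
    by rewrite ltr_wpDl// addr_ge0 ?mdist_ge0// fine_ge0// diam_ge0.
  move=> z Az; have := metric_triangle x a z.
  have az : mdist a z <= fine (diam A).
    rewrite -lee_fin fineK//; apply: ereal_sup_ubound; right;
      exists (a, z) => //.
  by move=> /le_trans; apply; rewrite -addrA lerD2l (le_trans az)// lerDl.
have ss0 : 0 < s - s0 by rewrite subr_gt0.
(* From [half^n <= 2 * r * t] follows [q * (half^n)^s0 <= t^s0 * b], and [(half^n)^(s - s0) <= q]
   for large [n]. *)
pose q : R := b / (2 * r) `^ s0.
have q0 : 0 < q by rewrite divr_gt0// powR_gt0// mulr_gt0.
have /andP[hs0 hs1] := half_powR_lt1 ss0.
have hs01 : 0 <= half `^ (s - s0) < 1 by rewrite hs1 ltW.
have [n1 n1P] := expr_small hs01 q0.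
pose n2 := maxn n0 n1.
have h0 n : 0 < half ^+ n by rewrite exprn_gt0// invr_gt0.
pose e := Num.min 1 (half ^+ n2 / r).
have e0 : 0 < e by rewrite lt_min ltr01 divr_gt0.
have [t [t0 te ft]] : exists t : R, [/\ 0 < t, t < e &
    (1 < ((t `^ s0)^-1)%:E * (@completed_measure_extension _ _ _ m
      (intermediate x A t) / m A))%E].
  have : (1 < ereal_sup [set (((t `^ s0)^-1)%:E *
      (@completed_measure_extension _ _ _ m (intermediate x A t) / m A))%E |
      t in [set t : R | (0 < t)%R /\ (t < e)%R]])%E.
    apply: lt_le_trans lim1 _; apply: ereal_inf_lbound.
    exists [set t : R | 0 < t /\ t < e] => //.
    exists e => //= u; rewrite /= sub0r normrN => ue u0; split => //.
    by rewrite gtr0_norm in ue.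
  by move=> /ereal_sup_gt[_ [t [t0 te] <-] ft]; exists t.
have t1 : t < 1 by move: te; rewrite lt_min => /andP[].
have tr : t * r < half ^+ n2 by move: te;
  rewrite lt_min ltr_pdivlMr// => /andP[].
have tr0 : 0 < t * r by rewrite mulr_gt0.
have tr1 : t * r < 1 by apply: lt_le_trans tr _;
  rewrite exprn_ile1// ?invr_ge0// invf_le1// ler1n.
have [n [nl nu]] := half_exp_ex tr0 tr1.
have n2n : (n2 <= n)%N.
  rewrite leqNgt; apply/negP => nn2.
  have : half ^+ n2 <= half ^+ n.+1.
    by apply: ler_wiXn2l => //; rewrite ?invr_ge0// invf_le1// ler1n.
  by have := le_lt_trans nl tr; rewrite ltNge => /negP.
exists n; first by apply: leq_trans n2n; exact: leq_maxl.
have n1n : (n1 <= n)%N by apply: leq_trans n2n; exact: leq_maxr.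
have ts0 : 0 < t `^ s0 by rewrite powR_gt0.
have hB : ((t `^ s0 * b)%:E <= m (B x (half ^+ n)))%E.
  have sub : (@completed_measure_extension _ _ _ m (intermediate x A t) <= m (B
    x (half ^+ n)))%E.
    rewrite -(measurable_mu_extE m (mball_measurable x _)); apply: le_mu_ext.
    move=> y /(intermediate_mball Ar (ltW t0) (ltW t1)) /= xy.
    exact: le_lt_trans xy nu.
  apply: le_trans sub.
  have := ltW ft; rewrite AE inver gt_eqF//.
  rewrite muleCA; rewrite -EFinM muleC.
  set v := completed_measure_extension _.
  have v0 : (0 <= v)%E by exact: mu_ext_ge0.
  move: v v0 => [v| |]// v0; last by rewrite leey.
  rewrite -EFinM !lee_fin -invfM mulrC ler_pdivlMr ?mulr_gt0// mul1r //.
apply: le_trans hB; rewrite lee_fin.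
have hq := n1P n n1n.
have -> : (half ^+ n) `^ s = (half ^+ n) `^ (s - s0) * (half ^+ n) `^ s0.
  by rewrite -powRD ?subrK// (gt_eqF (h0 n)) implybT.
rewrite (half_pow_powR n (s - s0)).
have h2 : (half ^+ n) `^ s0 <= (2 * r) `^ s0 * t `^ s0.
  have r20 : 0 <= 2 * r by rewrite mulr_ge0// ltW.
  rewrite -(powRM s0 r20 (ltW t0)).
  apply: ge0_ler_powR; rewrite ?nnegrE ?(ltW s00) ?(ltW (h0 n)) ?(mulr_ge0 r20
    (ltW t0))//.
  by move: nl; rewrite exprS; lra.
apply: (@le_trans _ _ (q * ((2 * r) `^ s0 * t `^ s0))).
  by apply: ler_pM; rewrite ?exprn_ge0 ?powR_ge0.
by rewrite /q mulrA divfK ?gt_eqF ?powR_gt0 ?mulr_gt0// mulrC.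
Qed.

End density.

Section dimension.
Context {R : realType} {X : completeMetricType R}.
Variable m : {measure set (borel X) -> \bar R}.
Hypothesis mfin : finite_on_bounded m.

Local Notation half := (2^-1 : R).
Local Notation B x r := [set y | (mdist x y < r)%R].

(* The points of [supp m] whose ball of radius [2^-n] is heavy, while the mass
  of
   the ball of radius [d(x0,x) + 1] around [x0] is at most [2^(n a)]; the latter
   replaces a global bound on [m]. *)
Let heavy (x0 : X) (s a : R) n : set X := [set x |
  (m (B x0 (mdist x0 x + 1)) <= ((half ^+ n) `^ a)^-1%:E)%E /\
  (((half ^+ n) `^ s)%:E <= m (B x (half ^+ n)))%E].

Let half0 : 0 < half. Proof. by rewrite invr_gt0. Qed.
Let half1 : half <= 1. Proof. by rewrite invf_le1// ler1n. Qed.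

(** Let [y] be the member of a separated list farthest from [x0]. As the radius is at most 1, all
    the balls lie in the ball around [x0] whose mass is controlled by the heaviness of [y]. *)
Lemma heavy_cover (x0 : X) (s a : R) n : exists F : seq X,
  (size F)%:R * (half ^+ n) `^ (s + a) <= 1 /\
  forall x, heavy x0 s a n x -> exists2 y, y \in F & mdist y x < 2 * half ^+ n.
Proof.
set h := half ^+ n; have h0 : 0 < h by exact: exprn_gt0.
have h1 : h <= 1 by rewrite exprn_ile1// ltW.
have sizeF F : pairwise (fun y z => 2 * h <= mdist y z) F ->
    (forall y, y \in F -> heavy x0 s a n y) -> (size F)%:R * h `^ (s + a) <= 1.
  case: F => [|y0 F] pF FP; first by rewrite mul0r.
  have [y yF ymax] : exists2 y, y \in y0 :: F &
      forall z, z \in y0 :: F -> mdist x0 z <= mdist x0 y.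
    elim: (F) (y0) => [|z1 F' IH] z0.
      by exists z0; rewrite ?mem_head// => z; rewrite inE => /eqP->.
    have [y yF' ymax] := IH z1; have [yz|zy] := leP (mdist x0 z0) (mdist x0 y).
      exists y; first by rewrite in_cons yF' orbT.
      by move=> z; rewrite in_cons => /orP[/eqP->//|]; exact: ymax.
    exists z0; first by rewrite mem_head.
    move=> z; rewrite in_cons => /orP[/eqP->//|/ymax zy'].
    exact: le_trans zy' (ltW zy).
  have [Hy _] := FP y yF.
  have := @separated_balls_measure _ _ m h (h `^ s) (y0 :: F) (B x0 (mdist x0 y
    + 1)) pF.
  move=> /(_ _ _ (mball_measurable _ _)) => /(_ _ _)/le_trans => /(_ _ _ _ Hy).
  rewrite lee_fin => H.
  have ha : 0 < h `^ a by exact: powR_gt0.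
  rewrite powRD; last by rewrite (gt_eqF h0) implybT.
  rewrite mulrA -ler_pdivlMr// div1r; apply: H.
    by move=> z zF; have [] := FP z zF.
  move=> z zF u /= zu; have := ymax z zF; have := metric_triangle x0 z u; lra.
have p0 : 0 < h `^ (s + a) by exact: powR_gt0.
have [|F [pF FP Fmax]] := @maximal_separated _ _ (heavy x0 s a n) h
    (Num.truncn (h `^ (s + a))^-1) h0.
  move=> F pF FP; rewrite truncn_ge_nat ?invr_ge0 ?(ltW p0)//.
  by rewrite -[leRHS]div1r ler_pdivlMr//; exact: sizeF.
by exists F; split; [exact: sizeF|exact: Fmax].
Qed.

Lemma hausdorff_meas_supp_eq0 (d s : R) : 0 <= d -> d < s ->
  (forall x, supp m x -> (dim_geo m x <= d%:E)%E) ->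
  hausdorff_meas s (supp m) = 0%E.
Proof.
move=> d0 ds dimd.
(* Of the excess over [d], one [e] makes the dimension bound strict, one pays for the mass of balls
   around [x0], and one makes the sum over scales geometric, of ratio [half^e]. *)
pose e := (s - d) / 3; have e0 : 0 < e by rewrite divr_gt0// subr_gt0.
pose s' := d + e; have dims x : supp m x -> (dim_geo m x < s'%:E)%E.
  by move=> /dimd /le_lt_trans; apply; rewrite lte_fin ltrDl.
have sE : s = s' + e + e by rewrite /s' /e; lra.
have s0 : 0 < s by lra.
apply/eqP; rewrite eq_le; apply/andP; split; last first.
  apply: le_trans (hausdorff_pre_ge0 s 1 (supp m)) _.
  by apply: ereal_sup_ubound; exists 1 => //=; exact: ltr01.
apply: ge_ereal_sup => _ [dl /= dl0 <-].
have [->|/set0P[x0 _]] := eqVneq (supp m) set0.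
  apply: le_trans (@hausdorff_pre_le_double _ _ s dl set0 (fun _ _ => set0) _
    _) _ => //.
    by move=> _ _; rewrite diam0 lee_fin ltW.
  rewrite eseries0// => i _ _; rewrite eseries0// => k _ _.
  by rewrite diam0 poweR0r// gt_eqF.
apply/lee_addgt0Pr => eps eps0; rewrite add0e.
have /choice[F FP] := heavy_cover x0 s' e.
have /andP[r0 r1] := half_powR_lt1 (R := R) e0.
set r := half `^ e in r0 r1.
have r01 : 0 <= r < 1 by rewrite r1 ltW.
have r1' : 0 < 1 - r by rewrite subr_gt0.
pose c : R := 4 `^ s; have c0 : 0 < c by rewrite powR_gt0.
have [n1 n1P] := expr_small r01 (divr_gt0 (mulr_gt0 eps0 r1') c0).
have h01 : 0 <= half < 1 by rewrite ltW//= invf_lt1// ltr1n.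
have [n2 n2P] := expr_small h01 (divr_gt0 dl0 (ltr0n R 4)).
(* [n1] makes the geometric tail at most [eps / c], [n2] makes the diameters, at most [4 * half^n],
   smaller than [dl]. *)
pose n0 := maxn n1 n2.
have h0 n : 0 < half ^+ n by exact: exprn_gt0.
pose G n k : set X := if (n0 <= n)%N && (k < size (F n))%N
  then B (nth x0 (F n) k) (2 * half ^+ n) else set0.
have diamG n k : (diam (G n k) <= (if (n0 <= n)%N then 4 * half ^+ n else
  0)%:E)%E.
  rewrite /G; case: (leqP n0 n) => //= _; last by rewrite diam0.
  case: ifP => _; last by rewrite diam0 lee_fin mulr_ge0// ltW.
  apply: le_trans (diam_mball_le _ _) _; first by rewrite mulr_ge0// ltW.
  by rewrite lee_fin mulrA -natrM.
have powG n k : (poweR (diam (G n k)) s <=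
    (if (n0 <= n)%N then c * (half ^+ n) `^ s else 0)%:E)%E.
  have dg := diamG n k; have dg0 := diam_ge0 (G n k).
  have dfin : diam (G n k) \is a fin_num.
    by rewrite ge0_fin_numE//; apply: le_lt_trans dg _; rewrite ltry.
  rewrite -(fineK dfin) poweR_EFin lee_fin.
  rewrite -(fineK dfin) lee_fin in dg; have fg0 := fine_ge0 dg0.
  move: dg; case: ifP => n0n dg.
    rewrite -(powRM s (ler0n R 4) (ltW (h0 n))).
    by apply: ge0_ler_powR; rewrite ?nnegrE ?(ltW s0)// mulr_ge0// ltW.
  have -> : fine (diam (G n k)) = 0 by apply/eqP; rewrite eq_le dg fg0.
  by rewrite powR0// gt_eqF.
have sumG n : (\sum_(k <oo) poweR (diam (G n k)) s <=
    c%:E * (if (n0 <= n)%N then r ^+ n else 0)%:E)%E.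
  have [nn0|n0n] := ltnP n n0.
    rewrite mule0 eseries0// => k _ _.
    by rewrite /G leqNgt nn0 diam0 poweR0r// gt_eqF.
  apply: le_trans (@nneseries_finite_le _ _ (size (F n)) (c * (half ^+ n) `^ s)
    _ _ _ _) _.
  - by rewrite mulr_ge0// ?powR_ge0// ltW.
  - by move=> k; exact: poweR_ge0.
  - by move=> k; have := powG n k; rewrite n0n.
  - by move=> k kF; rewrite /G ltnNge kF andbF diam0 poweR0r// gt_eqF.
  rewrite -EFinM lee_fin mulrCA ler_pM2l// {1}sE.
  rewrite [in leLHS]powRD; last by rewrite (gt_eqF (h0 n)) implybT.
  rewrite mulrA -half_pow_powR; apply: ler_piMl; first exact: powR_ge0.
  by have [] := FP n.
apply: le_trans (@hausdorff_pre_le_double _ _ s dl (supp m) G _ _) _.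
- move=> x xm; have Mfin := mball_lty mfin x0 (mdist x0 x + 1).
  set M := m (B x0 (mdist x0 x + 1)) in Mfin.
  have M0 : (0 <= M)%E by exact: measure_ge0.
  have ME : M = (fine M)%:E by rewrite fineK// ge0_fin_numE.
  have fM0 : 0 <= fine M by exact: fine_ge0.
  have q0 : 0 < (fine M + 1)^-1 by rewrite invr_gt0 ltr_wpDl.
  (* The mass around [x0] depends on [x] but is finite, so it is below [r^-n] once [n >= n3];
     infinitely many good scales remain for [x]. *)
  have [n3 n3P] := expr_small r01 q0.
  have [n n03 nx] := dim_geo_density (dims x xm) (maxn n0 n3).
  have n0n : (n0 <= n)%N by apply: leq_trans n03; exact: leq_maxl.
  have n3n : (n3 <= n)%N by apply: leq_trans n03; exact: leq_maxr.
  have [_ Fx] := FP n; have [|y yF yx] := Fx x.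
    split => //; rewrite -/M ME lee_fin half_pow_powR -/r.
    apply: (@le_trans _ _ (fine M + 1)); first by rewrite lerDl.
    by rewrite -[leLHS]invrK lef_pV2 ?posrE ?exprn_gt0//; exact: n3P.
  exists n => //; exists (index y (F n)) => //.
  by rewrite /G n0n index_mem yF nth_index.
- move=> n k; apply: le_trans (diamG n k) _; rewrite lee_fin.
  case: ifP => n0n; last exact: ltW.
  rewrite mulrC -ler_pdivlMr//; apply: n2P; apply: leq_trans n0n;
    exact: leq_maxr.
apply: (@le_trans _ _ (\sum_(n <oo) (c%:E * (if (n0 <= n)%N then r ^+ n else
  0)%:E))%E).
  apply: lee_nneseries => [n _ _|n *]; last exact: sumG.
  by apply: nneseries_ge0 => k _ _; exact: poweR_ge0.
rewrite nneseriesZl; last first.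
  by move=> n _; rewrite lee_fin; case: ifP => // _; rewrite exprn_ge0// ltW.
apply: (@le_trans _ _ (c%:E * (r ^+ n0 / (1 - r))%:E)%E).
  by apply: lee_wpmul2l; [rewrite lee_fin ltW|exact: geometric_tail_le].
rewrite -EFinM lee_fin mulrA ler_pdivrMr// mulrC -ler_pdivlMr//.
by apply: n1P; exact: leq_maxl.
Qed.

(** The bound [d] serves to make [D] finite, so that exponents [fine D + e] can be tested. *)
Lemma dim_haus_le_dim_geo (d : R) :
  (forall x, supp m x -> (dim_geo m x <= d%:E)%E) ->
  (dim_haus (supp m) <= dim_geo_set m (supp m))%E.
Proof.
move=> dimd; set D := dim_geo_set m (supp m).
have D0 : (0 <= D)%E by apply: ereal_sup_ubound; left.
have Dle x : supp m x -> (dim_geo m x <= D)%E.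
  by move=> xm; apply: ereal_sup_ubound; right; exists x.
have Dfin : D \is a fin_num.
  rewrite ge0_fin_numE//; apply: (@le_lt_trans _ _ (Num.max 0 d)%:E);
    last by rewrite ltry.
  apply: ge_ereal_sup => _ [->|[x xm <-]]; first by rewrite lee_fin le_max lexx.
  by apply: le_trans (dimd x xm) _; rewrite lee_fin le_max lexx orbT.
rewrite -(fineK Dfin); apply/lee_addgt0Pr => e e0; apply: ereal_inf_lbound.
have fD0 : 0 <= fine D by exact: fine_ge0.
exists (fine D + e); last by rewrite EFinD.
split; first by rewrite ltr_wpDl.
apply: (@hausdorff_meas_supp_eq0 (fine D)) => //; first by rewrite ltrDl.
by move=> x xm; rewrite fineK//; exact: Dle.
Qed.

End dimension.

Theorem theorem4p20 (R : realType) (X : completeMetricType R)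
    (m : {measure set (borel X) -> \bar R}) (G : X * X -> \bar R)
    (N : R) (beta : R -> \bar R -> \bar R) :
  separable X -> finite_on_bounded m -> gauge G ->
  (forall x, supp m x ->
    (0 < m [set z : X | z <> x /\ (G (x, z) < +oo)%E])%E) ->
  1 <= N -> distortion_coefficient N beta ->
  MCP m G beta ->
  (forall x, supp m x -> (dim_geo m x <= N%:E)%E) /\
  (dim_haus (supp m) <= dim_geo_set m (supp m) <= N%:E)%E.
Proof.
move=> sX mfin gG nontriv N1 hbeta hmcp.
have dimN x : supp m x -> (dim_geo m x <= N%:E)%E.
  by move=> xm; exact: (dim_geo_le sX mfin gG N1 hbeta hmcp xm (nontriv x xm)).
split => //; apply/andP; split; first exact: dim_haus_le_dim_geo dimN.
apply: ge_ereal_sup => _ [->|[x xm <-]]; last exact: dimN.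
by rewrite lee_fin (le_trans ler01).
Qed.
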